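(* Consider the real-valued block-sparse setting in the context with Gaussian noise $w\sim N(0,\sigma^2 I_L)$, and assume $x\ne0$. Suppose that for some constant $\alpha\ge 1/(2d\log N)$, $$(1-(d-1)\nu)x_{\min}-(2k-1)d\mu_B x_{\max}\ \ge\ 2\sigma\sqrt{2\alpha d(1+(d-1)\nu)\log N}.$$ Then, with probability exceeding $$1-\frac{0.8\,d\,(2\alpha d\log N)^{d/2-1}}{N^{\alpha d-1}},$$ the BTH algorithm satisfies $S\subseteq\hat S$ (it identifies the correct support of $x$) and $$\|\hat x_{\mathrm{BTH}}-x\|_2^2\le\frac{2\alpha(1+(d-1)\nu)}{(1-(d-1)\nu-(k-1)d\mu_B)^2}\,d\,k\,\sigma^2\log N.$$
   Context: Setting: $N=Md$, $\log$ is the natural logarithm. For $v\in\mathbb{R}^N$, $v[i]=(v_{(i-1)d+1},\dots,v_{id})^T$ is its $i$-th block ($1\le i\le M$); for a matrix $A$ with $N$ columns, $A[i]$ is the submatrix of columns $(i-1)d+1,\dots,id$. The block support is $\mathrm{supp}(v)=\{i:v[i]\ne0\}$; for $I=\{i_1<\dots<i_p\}$, $v_I$ concatenates $v[i_1],\dots,v[i_p]$ and $A_I=[A[i_1],\dots,A[i_p]]$. The unknown deterministic $x\in\mathbb{R}^N$ has at most $k$ nonzero blocks ($k$ known); $S=\mathrm{supp}(x)$, $s=|S|$, $x_{\max}=\max_{i\in S}\|x[i]\|_2$, $x_{\min}=\min_{i\in S}\|x[i]\|_2$. Observations $y=Dx+w$, with $D\in\mathbb{R}^{L\times N}$ known,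 columns $d_1,\dots,d_N$ of unit $\ell_2$ norm, $L<N$, and $D_I$ of full column rank for all $|I|\le k$. Block coherence $\mu_B=\max_{i\ne j}\frac1d\|D[i]^TD[j]\|$ (spectral norm); sub-coherence $\nu=\max_{1\le\ell\le M}\max_{(\ell-1)d+1\le i\ne j\le\ell d}|d_i^Td_j|$. BTH algorithm: compute $\rho_i=\|D[i]^Ty\|_2$, $i=1,\dots,M$; choose a set $\hat S$ of $k$ indices with $\rho_i\ge\rho_j$ for all $i\in\hat S$, $j\notin\hat S$ (ties arbitrary); output $\hat x_{\mathrm{BTH}}$ with $(\hat x_{\mathrm{BTH}})_{\hat S}=D_{\hat S}^\dagger y$ and zero on the other blocks ($^\dagger$ = Moore–Penrose pseudoinverse). *)

(* Defs.v *)
From HB Require Import structures.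
From mathcomp Require Import all_boot all_order all_algebra.
From mathcomp Require Import all_classical all_reals all_analysis.
Set Implicit Arguments. Unset Strict Implicit. Unset Printing Implicit Defensive.
Import Order.TTheory GRing.Theory Num.Theory.
Local Open Scope classical_set_scope.
Local Open Scope ring_scope.

Section BlockDefs.
Variable R : realType.

(* 0-based index of the t-th entry of the i-th block: i*d + t
   (paper: block i (1-based) = entries (i-1)d+1, ..., id). *)
Lemma blkidx_subproof (M d : nat) (i : 'I_M) (t : 'I_d) : (i * d + t < M * d)%N.
Proof.
have Hi := ltn_ord i; have Ht := ltn_ord t.
apply: (@leq_trans (i.+1 * d)); first by rewrite mulSn addnC ltn_add2r.
by rewrite leq_mul2r Hi orbT.
Qed.

Definition blkidx (M d : nat) (i : 'I_M) (t : 'I_d) : 'I_(M * d) :=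
  Ordinal (blkidx_subproof i t).

Definition blk_mx (L M d : nat) (A : 'M[R]_(L, M * d)) (i : 'I_M) : 'M[R]_(L, d) :=
  \matrix_(r, t) A r (blkidx i t).

Definition blk_vec (M d : nat) (v : 'cV[R]_(M * d)) (i : 'I_M) : 'cV[R]_d :=
  \col_t v (blkidx i t) 0.

Definition bsupp (M d : nat) (v : 'cV[R]_(M * d)) : {set 'I_M} :=
  [set i | blk_vec v i != 0].

Definition norm2 (n : nat) (v : 'cV[R]_n) : R := Num.sqrt (\sum_i (v i 0) ^+ 2).

Definition opnorm (m n : nat) (A : 'M[R]_(m, n)) : R :=
  sup [set norm2 (A *m v) | v in [set v : 'cV[R]_n | norm2 v = 1]].

Definition subD (L M d : nat) (A : 'M[R]_(L, M * d)) (I : {set 'I_M})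
  : 'M[R]_(L, \sum_(j < #|I|) d) :=
  @mxrow R #|I| (fun _ => d) L (fun j => blk_mx A (enum_val j)).

Definition subv (M d : nat) (v : 'cV[R]_(M * d)) (I : {set 'I_M})
  : 'cV[R]_(\sum_(j < #|I|) d) :=
  @mxcol R #|I| (fun _ => d) 1 (fun j => blk_vec v (enum_val j)).

Definition blk_coherence (L M d : nat) (D : 'M[R]_(L, M * d)) : R :=
  \big[Num.max/0]_(i : 'I_M) \big[Num.max/0]_(j : 'I_M | i != j)
     (opnorm ((blk_mx D i)^T *m blk_mx D j) / d%:R).

Definition sub_coherence (L M d : nat) (D : 'M[R]_(L, M * d)) : R :=
  \big[Num.max/0]_(l : 'I_M) \big[Num.max/0]_(t : 'I_d)
    \big[Num.max/0]_(u : 'I_d | t != u)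
      `|((col (blkidx l t) D)^T *m col (blkidx l u) D) 0 0|.

Definition is_pinv (m n : nat) (A : 'M[R]_(m, n)) (B : 'M[R]_(n, m)) : Prop :=
  [/\ A *m B *m A = A, B *m A *m B = B,
      (A *m B)^T = A *m B & (B *m A)^T = B *m A].

(* Shat, xhat is a possible output of BTH (any tie-breaking) on input D, y, k *)
Definition BTH_output (L M d : nat) (D : 'M[R]_(L, M * d)) (y : 'cV[R]_L) (k : nat)
  (Shat : {set 'I_M}) (xhat : 'cV[R]_(M * d)) : Prop :=
  let rho := fun i : 'I_M => norm2 ((blk_mx D i)^T *m y) in
  [/\ #|Shat| = k,
      (forall i j, i \in Shat -> j \notin Shat -> rho j <= rho i),
      (forall i, i \notin Shat -> blk_vec xhat i = 0) &
      (forall B, is_pinv (subD D Shat) B -> subv xhat Shat = B *m y)].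

End BlockDefs.

Definition mutually_independent (R : realType) (dT : measure_display)
  (T : measurableType dT) (P : probability T R) (n : nat) (X : 'I_n -> T -> R) : Prop :=
  forall B : 'I_n -> set R, (forall j, measurable (B j)) ->
    P (\bigcap_(j in [set: 'I_n]) (X j @^-1` B j)) = (\prod_(j < n) P (X j @^-1` B j))%E.

(* Main.v *)
Require Import Defs.
From HB Require Import structures.
From mathcomp Require Import all_boot all_order all_algebra.
From mathcomp Require Import all_classical all_reals all_analysis.
From mathcomp Require Import measurable_realfun zify ring lra.
Import Order.TTheory GRing.Theory Num.Theory.
Import numFieldNormedType.Exports.
Local Open Scope classical_set_scope.
Local Open Scope ring_scope.

(* Put t = 2 alpha d log N >= 1 and tau^2 = sigma^2 t (1 + (d-1) nu).  On the event that
   every ||D[i]^T w|| is below tau, the coherence gap makes each correlation rho_i with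
   i in S exceed every rho_j with j outside S, so S is contained in Shat; the least-squares
   error is then read off the normal equations and the block Gershgorin lower bound
   1 - (d-1) nu - (k-1) d mu_B on the Gram matrix.

   The probability of the complement is at most M times P(||D[i]^T w|| >= tau).  Plane
   rotations preserve the law of an iid centred Gaussian vector and bring D[i]^T to lower
   triangular form, so ||D[i]^T w||^2 is at most (1 + (d-1) nu) times a sum of d squares of
   independent N(0, sigma^2) variables.  The tail of that sum is bounded by induction on d,
   conditioning on one variable at a time: the Gaussian density of that variable exactly
   compensates the shift of the exponential factor, leaving only a power of t to integrate.
   The constant produced by d = 1 is sqrt (2 / pi) < 4 / 5. *)

(** * Independence *)

Section Independence.
Context {R : realType} {dT : measure_display} {T : measurableType dT} (P : probability T R).

(** The factor d in the failure probability is bookkeeping. The sum of n squares gets a tail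
    constant K n^2 with K = sqrt (2 / pi); summing over M blocks gives M d^2 = N d, and exp (- t /
    2) = N^(- alpha d). The shape n^2 is stable because passing from n to n + 1 costs 1 + K n^2,
    which is at most (n + 1)^2 since K <= 1. One step of that induction is irregular. The exponent n
    / 2 - 1 is negative at n = 1, so the one-variable bound blows up at 0 and cannot be replaced by
    its value at the threshold; the passage from 1 to 2 integrates a regularized bound, whose
    antiderivative is an arcsine. From n = 2 on the power is nondecreasing and a constant majorant
    is enough. Independence is given only through rectangles. All changes of variables therefore act
    on two coordinates at a time, so that only measures on the plane have to be identified. *)

Lemma measurable_preimageT {d1 d2} {T1 : measurableType d1} {T2 : measurableType d2}
  (f : T1 -> T2) (B : set T2) : measurable_fun setT f -> measurable B ->
  measurable (f @^-1` B).
Proof. by move=> mf mB; rewrite -[X in measurable X]setTI; exact: mf. Qed.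

Lemma measurable_superlevel {d1} {T1 : measurableType d1} (f : T1 -> R) (a : R) :
  measurable_fun setT f -> measurable [set t | a <= f t].
Proof.
move=> mf; rewrite (_ : [set _ | _] = f @^-1` `[a, +oo[%classic).
  by apply: measurable_preimageT => //; exact: measurable_itv.
by apply/seteqP; split => t /=; rewrite in_itv/= andbT.
Qed.

Definition pushforward_measure {d1 d2} {T1 : measurableType d1} {T2 : measurableType d2}
    (m : {measure set T1 -> \bar R}) (f : T1 -> T2) (mf : measurable_fun setT f)
  : {measure set T2 -> \bar R} :=
  measure_function_pushforward__canonical__measure_function_Measure m mf.

Lemma rectangle_measure_unique (m1 m2 : {measure set (R * R) -> \bar R}) :
  (m1 setT < +oo)%E ->
  (forall A B : set R, measurable A -> measurable B -> m1 (A `*` B) = m2 (A `*` B)) ->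
  forall X, measurable X -> m1 X = m2 X.
Proof.
move=> m1oo m12.
pose G : set (set (R * R)) := [set A `*` B | A in measurable & B in measurable].
have GI : setI_closed G.
  move=> _ _ [A mA [B mB <-]] [A' mA' [B' mB' <-]].
  exists (A `&` A'); first exact: measurableI.
  by exists (B `&` B'); [exact: measurableI|rewrite setXI].
have GT : G setT by exists setT => //; exists setT => //; exact: setXTT.
move=> X mX; apply: (measure_unique G (fun=> setT)) => //.
- exact: measurable_prod_measurableType.
- by rewrite bigcup_const//; exists 0%N.
- by move=> _ [A mA [B mB <-]]; exact: m12.
Qed.

Definition others {n} (i j : 'I_n) (X : 'I_n -> T -> R) (B : 'I_n -> set R) : set T :=
  \bigcap_(l in [set l | l != i /\ l != j]) X l @^-1` B l.

Lemma measurable_others n (i j : 'I_n) (X : 'I_n -> T -> R) (B : 'I_n -> set R) :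
  (forall l, measurable_fun setT (X l)) -> (forall l, measurable (B l)) ->
  measurable (others i j X B).
Proof.
move=> mX mB; apply: fin_bigcap_measurable; first exact: finite_finset.
by move=> l _; exact: measurable_preimageT.
Qed.

Lemma pair_others_rect n (X : 'I_n -> T -> R) (i j : 'I_n) (A A' : set R) (B : 'I_n -> set R) :
  mutually_independent P X -> i != j ->
  measurable A -> measurable A' -> (forall l, measurable (B l)) ->
  P (X i @^-1` A `&` X j @^-1` A' `&` others i j X B) =
  (P (X i @^-1` A) * P (X j @^-1` A') *
   \prod_(l | (l != i) && (l != j)) P (X l @^-1` B l))%E.
Proof.
move=> indX ij mA mA' mB.
pose B' l := if l == i then A else if l == j then A' else B l.
have mB' l : measurable (B' l) by rewrite /B'; do 2 case: ifP => // _.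
have -> : X i @^-1` A `&` X j @^-1` A' `&` others i j X B =
  \bigcap_(l in [set: 'I_n]) (X l @^-1` B' l).
  apply/seteqP; split => [t [[tA tA'] tB] l _|t tB].
    rewrite /= /B'; case: eqVneq => [->//|li]; case: eqVneq => [->//|lj].
    exact: tB.
  split; first split.
  - by have := tB i I; rewrite /= /B' eqxx.
  - by have := tB j I; rewrite /= /B' eq_sym (negbTE ij) eqxx.
  - by move=> l [/negbTE li /negbTE lj]; have := tB l I; rewrite /= /B' li lj.
rewrite indX// (bigD1 i)//= (bigD1 j) 1?eq_sym//=.
rewrite {1}/B' eqxx {1}/B' eqxx eq_sym (negbTE ij) muleA; congr (_ * _)%E.
by apply: eq_bigr => l /andP[/negbTE li /negbTE lj]; rewrite /B' li lj.
Qed.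

Lemma others_prod n (X : 'I_n -> T -> R) (i j : 'I_n) (B : 'I_n -> set R) :
  mutually_independent P X -> i != j -> (forall l, measurable (B l)) ->
  P (others i j X B) = (\prod_(l | (l != i) && (l != j)) P (X l @^-1` B l))%E.
Proof.
move=> indX ij mB.
have := @pair_others_rect n X i j setT setT B indX ij measurableT measurableT mB.
by rewrite !preimage_setT !setTI probability_setT !mul1e.
Qed.

(** Both sides are finite measures in [A] that agree on rectangles, which form a pi-system. This
    upgrades the rectangle form of independence to arbitrary planar events, such as preimages under
    a rotation. *)
Lemma pair_others n (X : 'I_n -> T -> R) (i j : 'I_n) (A : set (R * R)) (B : 'I_n -> set R) :
  (forall l, measurable_fun setT (X l)) -> mutually_independent P X -> i != j ->
  measurable A -> (forall l, measurable (B l)) ->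
  P ((fun t => (X i t, X j t)) @^-1` A `&` others i j X B) =
  (P ((fun t => (X i t, X j t)) @^-1` A) * P (others i j X B))%E.
Proof.
move=> mX indX ij mA mB.
have mC := measurable_others _ i j _ _ mX mB.
have mf : measurable_fun setT (fun t => (X i t, X j t)).
  exact: measurable_fun_pair.
have PCfin : P (others i j X B) \is a fin_num by exact: fin_num_measure.
have q0 : 0 <= fine (P (others i j X B)) by rewrite fine_ge0.
pose q := NngNum q0.
have qE : (q%:num)%:E = P (others i j X B) by rewrite /= fineK.
pose X' := fun t => (X i t, X j t).
pose m1 := pushforward_measure (mrestr P mC) X' mf.
pose m2 : {measure set (R * R) -> \bar R} := mscale q (pushforward_measure P X' mf).
have m1E S : m1 S = P (X' @^-1` S `&` others i j X B) by [].
have m2E S : m2 S = (P (others i j X B) * P (X' @^-1` S))%E by rewrite -qE.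
have m12 : forall S, measurable S -> m1 S = m2 S.
  apply: rectangle_measure_unique.
    rewrite m1E preimage_setT setTI.
    by rewrite ltey_eq PCfin.
  move=> S S' mS mS'; rewrite m1E m2E others_prod//.
  have -> : X' @^-1` (S `*` S') = X i @^-1` S `&` X j @^-1` S' by [].
  rewrite pair_others_rect// muleC; congr (_ * _)%E.
  have := @pair_others_rect n X i j S S' (fun=> setT) indX ij mS mS' (fun=> measurableT).
  rewrite (_ : others _ _ _ _ = setT) ?setIT ?big1 ?mule1 => [<-//|l _|].
    by rewrite preimage_setT probability_setT.
  by apply/seteqP; split.
by have := m12 A mA; rewrite m1E m2E muleC.
Qed.

Definition replace_pair {n} (i j : 'I_n) (f g : R * R -> R) (X : 'I_n -> T -> R)
    (l : 'I_n) (t : T) : R :=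
  if l == i then f (X i t, X j t) else if l == j then g (X i t, X j t) else X l t.

Lemma measurable_replace_pair n (i j : 'I_n) f g (X : 'I_n -> T -> R) :
  (forall l, measurable_fun setT (X l)) ->
  measurable_fun setT f -> measurable_fun setT g ->
  forall l, measurable_fun setT (replace_pair i j f g X l).
Proof.
move=> mX mf mg l.
have mp : measurable_fun setT (fun t => (X i t, X j t)) by exact: measurable_fun_pair.
rewrite /replace_pair; case: (l == i); first exact: (measurableT_comp mf mp).
by case: (l == j) => //; exact: (measurableT_comp mg mp).
Qed.

(** Serves two purposes: rotating a pair of coordinates ([f], [g] linear), and merging two
    coordinates into one ([f] a sum, [g] constant). *)
Lemma indep_replace_pair n (X : 'I_n -> T -> R) (i j : 'I_n) (f g : R * R -> R) :
  (forall l, measurable_fun setT (X l)) -> mutually_independent P X -> i != j ->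
  measurable_fun setT f -> measurable_fun setT g ->
  (forall A B : set R, measurable A -> measurable B ->
    P ((fun t => f (X i t, X j t)) @^-1` A `&` (fun t => g (X i t, X j t)) @^-1` B) =
    (P ((fun t => f (X i t, X j t)) @^-1` A) * P ((fun t => g (X i t, X j t)) @^-1` B))%E) ->
  mutually_independent P (replace_pair i j f g X).
Proof.
move=> mX indX ij mf mg indfg B mB.
pose S := f @^-1` B i `&` g @^-1` B j.
have mS : measurable S by apply: measurableI; exact: measurable_preimageT.
have ji : (j == i) = false by rewrite eq_sym; exact/negbTE.
have -> : \bigcap_(l in [set: 'I_n]) (replace_pair i j f g X l @^-1` B l) =
    (fun t => (X i t, X j t)) @^-1` S `&` others i j X B.
  rewrite /replace_pair; apply/seteqP; split => [t tB|t [[/= tf tg] tB] l _].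
    split; first split => /=.
    - by have := tB i I; rewrite /= eqxx.
    - by have := tB j I; rewrite /= ji eqxx.
    - by move=> l [/negbTE li /negbTE lj]; have := tB l I; rewrite /= li lj.
  rewrite /=; case: eqVneq => [->//|li]; case: eqVneq => [->//|lj]; exact: tB.
rewrite pair_others// (indfg (B i) (B j))// others_prod//.
rewrite [RHS](bigD1 i)//= [in RHS](bigD1 j) 1?eq_sym//= muleA; congr (_ * _ * _)%E.
- by congr (P _); apply/seteqP; split => t; rewrite /replace_pair /= eqxx.
- by congr (P _); apply/seteqP; split => t; rewrite /replace_pair /= ji eqxx.
- apply: eq_bigr => l /andP[/negbTE li /negbTE lj].
  by congr (P _); apply/seteqP; split => t; rewrite /replace_pair /= li lj.
Qed.

Lemma indep_pair_law n (X : 'I_n -> T -> R) (i j : 'I_n)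
    (mi mj : probability (measurableTypeR R) R) (A : set (R * R)) :
  (forall l, measurable_fun setT (X l)) -> mutually_independent P X -> i != j ->
  (forall B, measurable B -> P (X i @^-1` B) = mi B) ->
  (forall B, measurable B -> P (X j @^-1` B) = mj B) ->
  measurable A ->
  P ((fun t => (X i t, X j t)) @^-1` A) = (mi \x mj)%E A.
Proof.
move=> mX indX ij lawi lawj mA.
have mf : measurable_fun setT (fun t => (X i t, X j t)) by exact: measurable_fun_pair.
have mf' : @measurable_fun _ _ T (measurableTypeR R * measurableTypeR R)%type setT
  (fun t => (X i t, X j t)) := mf.
apply/esym; apply: (@product_measure_unique _ _ _ _ _ mi mj
  (pushforward_measure P _ mf')) => //.
move=> S S' mS mS'.
have := @pair_others_rect n X i j S S' (fun=> setT) indX ij mS mS' (fun=> measurableT).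
rewrite (_ : others _ _ _ _ = setT); last by apply/seteqP; split.
rewrite setIT big1 ?mule1; last by move=> l _; rewrite preimage_setT probability_setT.
by rewrite lawi// lawj//.
Qed.

End Independence.

(** * Rotation invariance of the planar Gaussian measure *)

Section Gauss.
Context {R : realType}.
Local Notation mR := (measurableTypeR R).
Local Notation mu := (@lebesgue_measure R).

(** The Radon-Nikodym derivative and the explicit density have the same integral over every
    measurable set, hence agree almost everywhere. *)
Lemma integral_normal_prob (m sigma : R) (f : mR -> \bar R) :
  (normal_prob m sigma).-integrable setT f ->
  (\int[normal_prob m sigma]_x f x = \int[mu]_x (f x * (normal_pdf m sigma x)%:E))%E.
Proof.
move=> intf; have mf := measurable_int _ intf.
have dom := normal_prob_dominates m sigma.
have mpdf : measurable_fun setT (fun x => (normal_pdf m sigma x)%:E).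
  by apply/measurable_EFinP; exact: measurable_normal_pdf.
rewrite -(Radon_Nikodym_change_of_variables dom)//=.
apply: ae_eq_integral => //; last first.
- apply: ae_eqe_mul2l; apply: integral_ae_eq => //.
  + exact: Radon_Nikodym_integrable.
  + by move=> E _ mE; rewrite -Radon_Nikodym_integral.
- exact: emeasurable_funM.
- by apply: emeasurable_funM => //; apply: (measurable_int mu).
Qed.

Lemma ge0_integral_shift (f : mR -> \bar R) (a : R) :
  measurable_fun setT f -> (forall x, 0 <= f x)%E ->
  (\int[mu]_x f (x + a)%R = \int[mu]_x f x)%E.
Proof.
move=> mf f0.
have msh : @measurable_fun _ _ mR mR setT (fun x : R => x + a).
  by apply: measurable_funD.
rewrite -(@ge0_integral_pushforward _ _ mR mR R (fun x : R => x + a) msh mu setT f)//.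
apply: (@eq_measure_integral _ mR R setT mu (pushforward_measure mu _ msh)) => A mA _.
apply/esym.
apply: (@lebesgue_measure_unique R (pushforward_measure mu _ msh)) => // _ [[b c]] _ <-.
rewrite /= /pushforward/=.
rewrite [X in _ = lebesgue_measure X](_ : _ = `]b - a, c - a]%classic); last first.
  by apply/seteqP; split => x /=; rewrite !in_itv/=; move=> /andP[? ?]; apply/andP; split; lra.
rewrite lebesgue_measure_itv/= !lebesgue_measure_itv/= !lte_fin ltrD2r.
by rewrite !EFinB; case: ifP => // _; rewrite -!EFinB; congr (_%:E); ring.
Qed.


Lemma measurable_fun_pair_affine (a b c d : R) :
  @measurable_fun _ _ (mR * mR)%type (mR * mR)%type setT
    (fun z => (a * z.1 + b * z.2, c * z.1 + d * z.2) : mR * mR).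
Proof.
have h (u v : R) : @measurable_fun _ _ (mR * mR)%type mR setT (fun z => u * z.1 + v * z.2).
  by apply: (@measurable_funD _ _ R); apply: (@measurable_funM _ _ R).
exact: measurable_fun_pair (h a b) (h c d).
Qed.

Local Notation I2 G := (\int[mu]_x \int[mu]_y G (x, y))%E.

(** For a fixed second coordinate the shear is a translation; Tonelli makes the first coordinate the
    inner variable. *)
Lemma integral2_shear_fst (G : mR * mR -> \bar R) (a : R) :
  measurable_fun setT G -> (forall z, 0 <= G z)%E ->
  I2 (fun z => G (z.1 + a * z.2, z.2)%R) = I2 G.
Proof.
move=> mG G0.
have mG' : measurable_fun setT (fun z : mR * mR => G (z.1 + a * z.2, z.2)%R).
  have := measurableT_comp mG (measurable_fun_pair_affine 1 a 0 1).
  by congr (measurable_fun _ _); apply/funext => z /=; rewrite mul1r mul0r add0r mul1r.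
apply: (etrans (@fubini_tonelli _ _ mR mR R mu mu _ mG' (fun=> G0 _))).
apply: (etrans _ (esym (@fubini_tonelli _ _ mR mR R mu mu G mG G0))).
apply: eq_integral => y _.
exact: (ge0_integral_shift (fun x => G (x, y)) (a * y)
  (measurableT_comp mG (measurable_pair2 y)) (fun=> G0 _)).
Qed.

Lemma integral2_shear_snd (G : mR * mR -> \bar R) (b : R) :
  measurable_fun setT G -> (forall z, 0 <= G z)%E ->
  I2 (fun z => G (z.1, z.2 + b * z.1)%R) = I2 G.
Proof.
move=> mG G0; apply: eq_integral => x _.
exact: (ge0_integral_shift (fun y => G (x, y)) (b * x)
  (measurableT_comp mG (measurable_pair1 x)) (fun=> G0 _)).
Qed.

(* A rotation is a product of three shears, each of which preserves Lebesgue measure. *)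
Lemma integral2_rotation (G : mR * mR -> \bar R) (c s : R) :
  c ^+ 2 + s ^+ 2 = 1 -> s != 0 ->
  measurable_fun setT G -> (forall z, 0 <= G z)%E ->
  I2 (fun z => G (c * z.1 - s * z.2, s * z.1 + c * z.2)%R) = I2 G.
Proof.
(* For angle theta, [a] is - tan (theta / 2): the shears are horizontal by [a], vertical by [s],
   horizontal by [a]. The division is why [s != 0] is assumed. *)
move=> cs s0 mG G0; pose a := (c - 1) / s.
have as1 : a * s = c - 1 by rewrite divfK.
have aE : a * (1 + c) = - s.
  apply: (mulIf s0); rewrite mulrAC as1 mulNr -expr2; have := cs; nra.
apply: (etrans _ (integral2_shear_fst G a mG G0)).
pose G1 z := G (z.1 + a * z.2, z.2)%R.
have mG1 : measurable_fun setT G1.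
  have := measurableT_comp mG (measurable_fun_pair_affine 1 a 0 1).
  by congr (measurable_fun _ _); apply/funext => z /=; rewrite /G1 mul1r mul0r add0r mul1r.
apply: (etrans _ (integral2_shear_snd G1 s mG1 (fun=> G0 _))).
pose G2 z := G1 (z.1, z.2 + s * z.1)%R.
have mG2 : measurable_fun setT G2.
  have := measurableT_comp mG1 (measurable_fun_pair_affine 1 0 s 1).
  congr (measurable_fun _ _); apply/funext => z /=.
  by rewrite /G2 !mul1r mul0r addr0 (addrC (s * _)).
apply: (etrans _ (integral2_shear_fst G2 a mG2 (fun=> G0 _))).
apply: eq_integral => x _; apply: eq_integral => y _ /=; rewrite /G2 /G1 /=.
have e2 : s * x + c * y = y + s * (x + a * y).
  by rewrite mulrDr mulrA (mulrC s a) as1; ring.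
have e1 : c * x - s * y = x + a * y + a * (y + s * (x + a * y)).
  rewrite -e2; transitivity (c * x + a * (1 + c) * y); first by rewrite aE; ring.
  transitivity (x + a * y + (a * s * x + a * c * y)); last by ring.
  by rewrite as1; ring.
by rewrite e1 e2.
Qed.

Lemma product_normal_prob_density (sigma : R) (m : probability mR R) (A : set (mR * mR)) :
  measurable A ->
  (normal_prob 0%R sigma \x m)%E A =
  (\int[mu]_x (m (xsection A x) * (normal_pdf 0 sigma x)%:E))%E.
Proof.
move=> mA; rewrite /product_measure1 integral_normal_prob//.
apply: (@le_integrable _ mR _ _ _ measurableT _ (cst 1%E)) => //.
- exact: (@measurable_fun_xsection _ _ mR mR R m).
- move=> x _ /=; rewrite normr1 gee0_abs//; apply: probability_le1.
  exact: measurable_xsection.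
- exact: (@finite_measure_integrable_cst _ mR).
Qed.

Lemma product_normal_probE (sigma : R) (A : set (mR * mR)) : measurable A ->
  (normal_prob 0%R sigma \x normal_prob 0%R sigma)%E A =
  I2 (fun z => (\1_A z * (normal_pdf 0 sigma z.1 * normal_pdf 0 sigma z.2))%:E).
Proof.
move=> mA; apply: (etrans (product_normal_prob_density sigma (normal_prob 0 sigma) A mA)).
apply: eq_integral => x _ /=.
rewrite {1}/normal_prob integral_mkcond/= -ge0_integralZr//=; first last.
- by rewrite lee_fin normal_pdf_ge0.
- by move=> y _; rewrite patchE; case: ifP => //; rewrite lee_fin normal_pdf_ge0.
- apply/(measurable_restrictT _ _).1; first exact: measurable_xsection.
  apply: measurable_funTS; apply/measurable_EFinP; exact: measurable_normal_pdf.
apply: eq_integral => y _; rewrite patchE indicE mem_xsection.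
by case: ifP => _; rewrite ?mul0e ?mul0r ?mul1r// mulrC.
Qed.

(** The product density depends only on x^2 + y^2, so it is carried along unchanged and only
    Lebesgue measure has to be rotated. *)
Lemma product_normal_prob_rotation (sigma c s : R) (A : set (mR * mR)) :
  sigma != 0 -> c ^+ 2 + s ^+ 2 = 1 -> s != 0 -> measurable A ->
  (normal_prob 0%R sigma \x normal_prob 0%R sigma)%E
    ((fun z => (c * z.1 - s * z.2, s * z.1 + c * z.2)) @^-1` A) =
  (normal_prob 0%R sigma \x normal_prob 0%R sigma)%E A.
Proof.
move=> sigma0 cs s0 mA.
have mrot := measurable_fun_pair_affine c (- s) s c.
have mB : measurable ((fun z : mR * mR => (c * z.1 - s * z.2, s * z.1 + c * z.2)) @^-1` A).
  have := measurable_preimageT _ _ mrot mA.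
  by congr measurable; apply/seteqP; split => z /=; rewrite mulNr.
apply: (etrans (product_normal_probE sigma _ mB)).
apply: (etrans _ (esym (product_normal_probE sigma A mA))).
pose H z := (\1_A z * (normal_pdf 0 sigma z.1 * normal_pdf 0 sigma z.2))%:E.
have mH : @measurable_fun _ _ (mR * mR)%type _ setT H.
  apply/measurable_EFinP; apply: measurable_funM; first exact: measurable_indic.
  by apply: measurable_funM; exact: (measurableT_comp (measurable_normal_pdf 0 sigma)).
have H0 z : (0 <= H z)%E.
  by rewrite lee_fin mulr_ge0// ?indicE// mulr_ge0 ?normal_pdf_ge0.
apply: (etrans _ (integral2_rotation H c s cs s0 mH H0)).
apply: eq_integral => x _; apply: eq_integral => y _ /=; congr (_ * _)%:E.
rewrite !normal_pdfE//= /normal_fun !subr0 mulrACA [RHS]mulrACA -!expRD.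
congr (_ * expR _); rewrite -!mulrDl; congr (_ / _).
have -> : (- (c * x - s * y) ^+ 2 - (s * x + c * y) ^+ 2) =
  - ((c ^+ 2 + s ^+ 2) * (x ^+ 2 + y ^+ 2)) by ring.
by rewrite cs mul1r opprD.
Qed.

End Gauss.

(** * Plane rotations and triangularization *)

Section Rotations.
Context {R : realType}.

Definition rotate {L} (i j : 'I_L) (c s : R) (v : 'I_L -> R) (l : 'I_L) : R :=
  if l == i then c * v i - s * v j else if l == j then s * v i + c * v j else v l.

Lemma rotate_dot L (i j : 'I_L) (c s : R) (u v : 'I_L -> R) :
  i != j -> c ^+ 2 + s ^+ 2 = 1 ->
  \sum_l rotate i j c s u l * rotate i j c s v l = \sum_l u l * v l.
Proof.
move=> ij cs; have ji : (j == i) = false by rewrite eq_sym; exact/negbTE.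
rewrite (bigD1 i)//= (bigD1 j) 1?eq_sym//= [RHS](bigD1 i)//= [in RHS](bigD1 j) 1?eq_sym//=.
rewrite !addrA /rotate !eqxx ji; congr (_ + _).
  transitivity ((c ^+ 2 + s ^+ 2) * (u i * v i + u j * v j)); first by ring.
  by rewrite cs mul1r.
by apply: eq_bigr => l /andP[/negbTE -> /negbTE ->].
Qed.

(** Phrased for any predicate [Q] stable under rotations, so that the noise and the Gram matrix can
    be transported without forming an orthogonal matrix. An entry that is already zero is left
    alone, so rotations with zero sine never occur. *)
Lemma givens_triangularize (d L : nat) (A : 'I_d -> 'I_L -> R)
    (Q : ('I_d -> 'I_L -> R) -> Prop) :
  Q A ->
  (forall A' i j c s, i != j -> c ^+ 2 + s ^+ 2 = 1 -> s != 0 ->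
    Q A' -> Q (fun r => rotate i j c s (A' r))) ->
  exists2 A', Q A' & forall (r : 'I_d) (l : 'I_L), (r < l)%N -> A' r l = 0.
Proof.
move=> QA Qrot.
suff: forall m, (m <= d)%N -> exists2 A', Q A' &
    forall (r : 'I_d) (l : 'I_L), (r < l)%N -> (r < m)%N -> A' r l = 0.
  by move=> /(_ d (leqnn d))[A' QA' A'0]; exists A' => // r l rl; exact: A'0.
elim=> [_|m IHm md]; first by exists A.
have [A0 QA0 A00] := IHm (ltnW md).
suff: forall q, (q <= L)%N -> exists2 A', Q A' &
    forall (r : 'I_d) (l : 'I_L), (r < l)%N -> (r < m)%N \/ (r == m :> nat) && (l < q)%N ->
    A' r l = 0.
  move=> /(_ L (leqnn L))[A' QA' A'0]; exists A' => // r l rl.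
  by rewrite ltnS leq_eqVlt => /orP[rm|rm]; apply: A'0 => //; [right; rewrite rm ltn_ord|left].
elim=> [_|q IHq qL].
  by exists A0 => // r l rl [rm|]; [exact: A00|rewrite ltn0 andbF].
have [A1 QA1 A10] := IHq (ltnW qL).
have [qm|mq] := leqP q m.
  by exists A1 => // r l rl [rm|/andP[/eqP rm lq]]; apply: A10 => //; [left|left; lia].
pose i : 'I_L := Ordinal (ltn_trans mq qL); pose j : 'I_L := Ordinal qL.
pose r0 : 'I_d := Ordinal md.
have ij : i != j by apply/eqP => /(congr1 val)/= ?; lia.
have ji : (j == i) = false by rewrite eq_sym; exact/negbTE.
have [b0|b0] := eqVneq (A1 r0 j) 0.
  exists A1 => // r l rl [rm|/andP[/eqP rm lq]]; first by apply: A10 => //; left.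
  have -> : r = r0 by exact: val_inj.
  move: lq; rewrite ltnS leq_eqVlt => /orP[/eqP lq|lq].
    by have -> : l = j by exact: val_inj.
  by apply: A10 => /=; [lia|right; rewrite eqxx].
pose a := A1 r0 i; pose b := A1 r0 j; pose n := Num.sqrt (a ^+ 2 + b ^+ 2).
have ab0 : 0 < a ^+ 2 + b ^+ 2.
  by rewrite ltr_wpDl ?sqr_ge0// exprn_even_gt0.
have n0 : n != 0 by rewrite gt_eqF// sqrtr_gt0.
have nE : n ^+ 2 = a ^+ 2 + b ^+ 2 by rewrite sqr_sqrtr// ltW.
(* With cosine a / n and sine - b / n the entry (m, q) becomes (- b a + a b) / n = 0, and [b0] keeps
   the sine nonzero. Rows above m vanish in both columns m and q, so their zeros survive. *)
exists (fun r => rotate i j (a / n) (- b / n) (A1 r)).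
  apply: Qrot => //; last by rewrite mulf_neq0 ?oppr_eq0 ?invr_eq0.
  rewrite !expr_div_n sqrrN -mulrDl nE divff//; exact: lt0r_neq0.
move=> r l rl rmq; rewrite /rotate.
case: eqP => [li|/eqP li].
  move: rl; rewrite li /= => rm.
  rewrite (A10 r i) ?(A10 r j) ?mulr0 ?subr0//; try by left.
  exact: (ltn_trans rm mq).
case: eqP => [lj|/eqP lj]; last first.
  apply: A10 => //; case: rmq => [|/andP[rm lq]]; [by left|right; rewrite rm /=].
  by move: lq; rewrite ltnS leq_eqVlt => /orP[/eqP lq|//]; rewrite -(inj_eq val_inj) /= lq eqxx in lj.
case: rmq => [rm|/andP[/eqP rm _]].
  rewrite (A10 r i) ?(A10 r j) ?mulr0 ?addr0//; try by left.
  exact: (ltn_trans rm mq).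
have -> : r = r0 by exact: val_inj.
by rewrite -/a -/b; ring.
Qed.

End Rotations.

(** * Gaussian noise under rotations *)

Section IidNormal.
Context {R : realType} {dT : measure_display} {T : measurableType dT} (P : probability T R).

Definition iid_normal (sigma : R) {L} (w : 'I_L -> T -> R) : Prop :=
  [/\ forall j, measurable_fun setT (w j), mutually_independent P w &
      forall j (B : set R), measurable B -> P (w j @^-1` B) = normal_prob 0 sigma B].

Lemma iid_normal_rotate (sigma : R) L (w : 'I_L -> T -> R) (i j : 'I_L) (c s : R) :
  sigma != 0 -> i != j -> c ^+ 2 + s ^+ 2 = 1 -> s != 0 ->
  iid_normal sigma w -> iid_normal sigma (fun l t => rotate i j c s (w ^~ t) l).
Proof.
move=> sigma0 ij cs s0 [mw indw laww].
have ji : (j == i) = false by rewrite eq_sym; exact/negbTE.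
pose f (z : R * R) := c * z.1 - s * z.2; pose g (z : R * R) := s * z.1 + c * z.2.
have mf : measurable_fun setT f.
  by apply: measurable_funB; apply: measurable_funM.
have mg : measurable_fun setT g.
  by apply: measurable_funD; apply: measurable_funM.
(* This single factorisation yields the marginals, by taking one set to be the whole line, and then
   the independence of the rotated pair. *)
have lawfg (A B : set R) : measurable A -> measurable B ->
    P ((fun t => f (w i t, w j t)) @^-1` A `&` (fun t => g (w i t, w j t)) @^-1` B) =
    (normal_prob 0%R sigma A * normal_prob 0%R sigma B)%E.
  move=> mA mB.
  have mAB : measurable ((fun z => (f z, g z)) @^-1` (A `*` B)).
    by apply: measurable_preimageT; [exact: measurable_fun_pair|exact: measurableX].
  have := indep_pair_law P _ w i j (normal_prob 0%R sigma) (normal_prob 0%R sigma) _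
    mw indw ij (laww i) (laww j) mAB.
  rewrite product_normal_prob_rotation//; last exact: measurableX.
  by rewrite product_measure1E.
have lawf (A : set R) : measurable A ->
    P ((fun t => f (w i t, w j t)) @^-1` A) = normal_prob 0%R sigma A.
  move=> mA; have := lawfg A setT mA measurableT.
  by rewrite preimage_setT setIT => ->; rewrite probability_setT mule1.
have lawg (B : set R) : measurable B ->
    P ((fun t => g (w i t, w j t)) @^-1` B) = normal_prob 0%R sigma B.
  move=> mB; have := lawfg setT B measurableT mB.
  by rewrite preimage_setT setTI => ->; rewrite probability_setT mul1e.
have -> : (fun l t => rotate i j c s (w ^~ t) l) = replace_pair i j f g w by [].
split; first exact: measurable_replace_pair.
  apply: indep_replace_pair => // A B mA mB.
  by rewrite [RHS](congr2 _ (lawf A mA) (lawg B mB)) lawfg.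
move=> l B mB; rewrite /replace_pair.
have [_|_] := eqVneq l i; first exact: lawf.
by have [_|_] := eqVneq l j; [exact: lawg|exact: laww].
Qed.

(* LQ factorisation: A = A' Q with A' lower triangular and Q orthogonal; then w' = Q w. *)
Lemma iid_normal_triangularize (sigma : R) d L (A : 'I_d -> 'I_L -> R) (w : 'I_L -> T -> R) :
  sigma != 0 -> iid_normal sigma w ->
  exists (A' : 'I_d -> 'I_L -> R) (w' : 'I_L -> T -> R), [/\ iid_normal sigma w',
    forall t r, \sum_l A' r l * w' l t = \sum_l A r l * w l t,
    forall r r', \sum_l A' r l * A' r' l = \sum_l A r l * A r' l &
    forall (r : 'I_d) (l : 'I_L), (r < l)%N -> A' r l = 0].
Proof.
move=> sigma0 iidw.
have [|A' i j c s ij cs s0 [[w' [iidw' A'w']] A'A']|A' [[w' [? ?]] ?] ?] :=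
  @givens_triangularize R d L A (fun A' => (exists w', iid_normal sigma w' /\
    forall t r, \sum_l A' r l * w' l t = \sum_l A r l * w l t) /\
    forall r r', \sum_l A' r l * A' r' l = \sum_l A r l * A r' l).
- by split => //; exists w.
- split; last by move=> r r'; rewrite rotate_dot.
  exists (fun l t => rotate i j c s (w' ^~ t) l); split; first exact: iid_normal_rotate.
  by move=> t r; rewrite rotate_dot.
- by exists A', w'; split.
Qed.

End IidNormal.

(** * The Gaussian tail *)

Section PiBound.
Context {R : realType}.

Lemma sin_le_id (x : R) : 0 <= x -> sin x <= x.
Proof.
move=> x0.
have [->|xn0] := eqVneq x 0; first by rewrite sin0.
have x_gt0 : 0 < x by rewrite lt_def xn0.
have [|c _] := @MVT_segment R sin cos 0 x x0.
  by apply: continuous_subspaceT => y; exact: continuous_sin.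
rewrite sin0 !subr0 => ->.
by rewrite -[leRHS]mul1r ler_wpM2r// cos_le1.
Qed.

(** Here [p] is pi, [c4], [c8], [c16] are the cosines of pi / 4, pi / 8, pi / 16, and [s] is sin (pi
    / 32). If p <= 25 / 8, doubling the angle back up forces 2 c4^2 > 1. The fractions are lower
    roundings of the successive cosines; the last one suffices because 2 * 46^2 = 4232 > 4225 =
    65^2. *)
Lemma half_angle_lower_bound (p c4 c8 c16 s : R) :
  0 = 2 * c4 ^+ 2 - 1 -> c4 = 2 * c8 ^+ 2 - 1 -> c8 = 2 * c16 ^+ 2 - 1 ->
  c16 = 1 - 2 * s ^+ 2 -> 0 <= s <= p / 32 -> 25 / 8 < p.
Proof.
have le_sqr (u v : R) : 0 <= u -> u <= v -> u ^+ 2 <= v ^+ 2.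
  by move=> u0 uv; rewrite !expr2 ler_pM.
move=> e4 e16 e8 es /andP[s0 sp]; rewrite ltNge; apply/negP => pile.
have s1 : s ^+ 2 <= (25 / 256) ^+ 2 by apply: le_sqr => //; lra.
have b16 : 205 / 209 <= c16 by rewrite es; clear -s1; lra.
have b8 : 73 / 79 <= c8.
  by have := le_sqr (205 / 209) c16 ltac:(lra) b16; clear -e8; lra.
have b4 : 46 / 65 <= c4.
  by have := le_sqr (73 / 79) c8 ltac:(lra) b8; clear -e16; lra.
by have := le_sqr (46 / 65) c4 ltac:(lra) b4; clear -e4; lra.
Qed.

(* Half-angle formulas down to pi / 16, then sin (pi / 32) <= pi / 32. *)
Lemma pi_gt_25div8 : 25 / 8 < pi :> R.
Proof.
have half (y : R) : cos (y *+ 2) = 2 * cos y ^+ 2 - 1 by rewrite cos_mulr2n mulr_natl.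
have dbl (n : nat) : pi / n.+1%:R = (pi / (n.+1 * 2)%:R) *+ 2 :> R.
  by rewrite natrM invfM mulrA -[RHS]mulr_natr divfK.
have p32 : 0 <= pi / 32 :> R by rewrite divr_ge0// pi_ge0.
apply: (half_angle_lower_bound _ (cos (pi / 4)) (cos (pi / 8)) (cos (pi / 16)) (sin (pi / 32))).
- by rewrite -half -(dbl 1%N) cos_pihalf.
- by rewrite -half -(dbl 3%N).
- by rewrite -half -(dbl 7%N).
- by rewrite (dbl 15%N) half cos2sin2; ring.
- rewrite sin_le_id// andbT sin_ge0_pi// p32/= ler_pdivrMr// ler_peMr ?pi_ge0//.
  by rewrite ler1n.
Qed.

End PiBound.

Section NormalTail.
Context {R : realType}.
Variables (sigma : R) (sigma_gt0 : 0 < sigma).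
Local Notation mR := (measurableTypeR R).
Local Notation mu := (@lebesgue_measure R).
Local Notation gam := (normal_prob 0 sigma).

(** This is sqrt (2 / pi), whatever [sigma]; being below 4 / 5 amounts, after squaring, to pi > 25 /
    8. *)
Definition two_peak : R := 2 * normal_peak sigma * sigma.

Lemma two_peak_sqr : two_peak ^+ 2 = 2 / pi.
Proof.
rewrite /two_peak /normal_peak !exprMn exprVn sqr_sqrtr; last first.
  by rewrite mulrn_wge0// mulr_ge0 ?sqr_ge0// pi_ge0.
rewrite -[sigma ^+ 2 * pi *+ 2]mulr_natr; have := @pi_gt0 R; generalize (pi : R) => p p0; field.
by apply/andP; split; apply: lt0r_neq0.
Qed.

Lemma two_peak_gt0 : 0 < two_peak.
Proof. by rewrite !mulr_gt0// normal_peak_gt0// gt_eqF. Qed.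

Lemma two_peak_lt : two_peak < 4 / 5.
Proof.
rewrite -(@ltr_pXn2r _ 2) ?nnegrE ?ltW ?two_peak_gt0//.
rewrite two_peak_sqr ltr_pdivrMr ?pi_gt0//.
by have := @pi_gt_25div8 R; generalize (pi : R) => p; lra.
Qed.

Lemma two_peak_ge : 1 / 2 <= two_peak.
Proof.
rewrite -(@ler_pXn2r _ 2) ?nnegrE ?(ltW two_peak_gt0) ?divr_ge0//.
rewrite two_peak_sqr ler_pdivlMr ?pi_gt0//.
by have := @pihalf_lt2 R; generalize (pi : R) => p; lra.
Qed.

Let pdf := normal_pdf 0 sigma.

Lemma pdfE x : pdf x = normal_peak sigma * expR (- (x ^+ 2) / (2 * sigma ^+ 2)).
Proof. by rewrite /pdf normal_pdfE ?gt_eqF// /normal_fun subr0 -mulr_natl. Qed.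

Lemma cvg_normal_pdf_pinfty : pdf x @[x --> +oo] --> (0 : R).
Proof.
have k0 : 0 < (Num.sqrt (2 * sigma ^+ 2))^-1.
  by rewrite invr_gt0 sqrtr_gt0 mulr_gt0// exprn_gt0.
have -> : pdf = (fun x => normal_peak sigma * gauss_fun (x * (Num.sqrt (2 * sigma ^+ 2))^-1)).
  apply/funext => x; rewrite pdfE /gauss_fun exprMn exprVn sqr_sqrtr ?mulNr//.
  by rewrite mulr_ge0 ?sqr_ge0.
rewrite -[X in _ --> X](mulr0 (normal_peak sigma)); apply: cvgMl_tmp.
apply: (cvg_comp _ _ _ (@cvg_gauss_fun R)).
by apply: gt0_cvgMly.
Qed.

(** Mills-ratio argument: beyond [a] the density is at most x / a times itself, and that product has
    an elementary antiderivative. *)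
Lemma normal_prob_halfline (a : R) : 0 < a ->
  (gam `[a, +oo[%classic <= (sigma ^+ 2 / a * pdf a)%:E)%E.
Proof.
move=> a0; rewrite /normal_prob.
pose f x := x / a * pdf x.
have cf : continuous f.
  move=> x; apply: cvgM; first by apply: cvgMr_tmp; exact: cvg_id.
  by apply: continuous_normal_pdf; rewrite gt_eqF.
have f0 x : a <= x -> 0 <= f x.
  by move=> ax; rewrite mulr_ge0 ?normal_pdf_ge0// divr_ge0 ?(ltW a0)// (le_trans _ ax)// ltW.
apply: (@le_trans _ _ (\int[mu]_(x in `[a, +oo[) (f x)%:E)%E).
  apply: ge0_le_integral => //=.
  - by move=> x _; rewrite lee_fin normal_pdf_ge0.
  - by apply: measurable_funTS; apply/measurable_EFinP; exact: measurable_normal_pdf.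
  - by apply: measurable_funTS; apply/measurable_EFinP; exact: continuous_measurable_fun.
  - move=> x; rewrite in_itv/= andbT => ax; rewrite lee_fin -[leLHS]mul1r.
    by rewrite ler_wpM2r ?normal_pdf_ge0// ler_pdivlMr// mul1r.
pose F x := - (sigma ^+ 2 / a * pdf x).
have dF (x : R) : is_derive x 1 F (f x).
  rewrite /F; have -> : (fun x => - (sigma ^+ 2 / a * pdf x)) = (fun x => - (sigma ^+ 2 / a) *
      normal_peak sigma * expR (- (x ^+ 2) / (2 * sigma ^+ 2))).
    by apply/funext => y; rewrite pdfE; ring.
  rewrite /f pdfE; apply: is_derive_eq.
  rewrite scaler0 add0r /GRing.scale/= mulr1; field.
  by rewrite !gt_eqF.
rewrite (@ge0_continuous_FTC2y R f F a 0)//.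
- by rewrite /F EFinN oppeK add0e.
- exact: continuous_subspaceT.
- rewrite /F -oppr0; apply: cvgN; rewrite -[X in _ --> X](mulr0 (sigma ^+ 2 / a)).
  by apply: cvgMl_tmp; exact: cvg_normal_pdf_pinfty.
- apply: cvg_at_right_filter; apply: differentiable_continuous.
  by apply/derivable1_diffP.
- by move=> x _; rewrite derive1E derive_val.
Qed.

Lemma normal_prob_tail (a : R) : 0 < a ->
  (gam [set x | (a ^+ 2 <= x ^+ 2)%R] <=
   (two_peak * (sigma / a) * expR (- (a ^+ 2) / (2 * sigma ^+ 2)))%:E)%E.
Proof.
move=> a0.
have -> : [set x | (a ^+ 2 <= x ^+ 2)%R] = `]-oo, -a]%classic `|` `[a, +oo[%classic.
  apply/seteqP; split => x /=; rewrite !in_itv/= andbT.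
    rewrite -ler_sqrt ?sqr_ge0// !sqrtr_sqr gtr0_norm// ler_normr => /orP[]; [by right|left; lra].
  by move=> [|] h; nra.
have eqN : gam `]-oo, - a]%classic = gam `[a, +oo[%classic.
  rewrite /normal_prob ge0_integration_by_substitutionNy.
  - by apply: eq_integral => x _; rewrite /= !normal_pdfE ?gt_eqF//= /normal_fun !subr0 sqrrN.
  - by apply: continuous_subspaceT; apply: continuous_normal_pdf; rewrite gt_eqF.
  - by move=> x _; rewrite normal_pdf_ge0.
have leN : (gam `]-oo, (- a)%R]%classic <= (sigma ^+ 2 / a * pdf a)%:E)%E.
  by rewrite eqN; exact: normal_prob_halfline.
apply: (le_trans (@measureU2 _ _ _ (normal_prob 0 sigma) _ _ _ _)) => //.
apply: (le_trans (leeD leN (normal_prob_halfline _ a0))).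
rewrite -EFinD lee_fin le_eqVlt; apply/orP; left; apply/eqP.
rewrite pdfE /two_peak; field.
by rewrite gt_eqF.
Qed.

End NormalTail.

(** * The chi-square tail *)

Section TailRec.
Context {R : realType}.
Variables (sigma : R) (sigma_gt0 : 0 < sigma).
Local Notation mR := (measurableTypeR R).
Local Notation mu := (@lebesgue_measure R).
Local Notation gam := (normal_prob 0 sigma).
Local Notation K := (two_peak sigma).
Local Notation decay s := (expR (- s / (2 * sigma ^+ 2))).

Lemma measurable_sqr_plus_tail (s : R) :
  measurable ([set z | s <= z.1 ^+ 2 + z.2] : set (mR * mR)).
Proof.
apply: (@measurable_superlevel R _ (mR * mR)%type (fun z => z.1 ^+ 2 + z.2)).
by apply: (@measurable_funD _ _ R) => //; exact: (@measurable_funX _ _ R _ _ 2).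
Qed.

(* The factor exp (- x^2 / (2 sigma^2)) of the density at [x] turns the decay of [m] at
   [a^2 - x^2] into the decay at [a^2], whatever [x]. *)
Lemma sqr_plus_tail_le (m : probability mR R) (a J : R) (g : R -> R) :
  0 < a -> measurable_fun `[-a, a] g -> (forall x, 0 <= g x) ->
  (\int[mu]_(x in `[(- a)%R, a]) (g x)%:E <= J%:E)%E ->
  (forall x, -a <= x <= a ->
    (m [set z | (a ^+ 2 - x ^+ 2 <= z)%R] <= (decay (a ^+ 2 - x ^+ 2) * g x)%:E)%E) ->
  ((gam \x m) [set z | (a ^+ 2 <= z.1 ^+ 2 + z.2)%R] <=
    (decay (a ^+ 2) * (K * (sigma / a) + normal_peak sigma * J))%:E)%E.
Proof.
move=> a0 mg g0 gJ mle; set A := [set z | _].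
have mA : measurable (A : set (mR * mR)) by exact: measurable_sqr_plus_tail.
rewrite product_normal_prob_density//.
have mI : measurable (`[-a, a]%classic : set mR) by exact: measurable_itv.
have mF : @measurable_fun _ _ mR _ setT
    (fun x => m (xsection A x) * (normal_pdf 0 sigma x)%:E)%E.
  apply: emeasurable_funM; first exact: (@measurable_fun_xsection _ _ mR mR R m).
  by apply/measurable_EFinP; exact: measurable_normal_pdf.
have F0 x : (0 <= m (xsection A x) * (normal_pdf 0 sigma x)%:E)%E.
  by rewrite mule_ge0// lee_fin normal_pdf_ge0.
(* Inside [-a, a] the assumed decay of [m] applies; outside, [m] is bounded by 1 and only the
   one-variable normal tail remains. *)
rewrite -(setUv `[-a, a]%classic) ge0_integral_setU//; last 3 first.
- exact: measurableC.
- by rewrite setUv.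
- by rewrite disj_set2E setICr.
rewrite mulrDr EFinD addeC; apply: leeD; last first.
  apply: (@le_trans _ _ (\int[mu]_(x in `[(- a)%R, a]) ((decay (a ^+ 2) * normal_peak sigma)%:E * (g x)%:E))%E).
    apply: ge0_le_integral => //.
    - exact: measurable_funTS.
    - by apply: emeasurable_funM => //; exact/measurable_EFinP.
    - move=> x; rewrite /= in_itv/= => xa.
      rewrite -EFinM.
      have -> : decay (a ^+ 2) * normal_peak sigma * g x =
          decay (a ^+ 2 - x ^+ 2) * g x * normal_pdf 0 sigma x.
        have -> : decay (a ^+ 2) = decay (a ^+ 2 - x ^+ 2) * decay (x ^+ 2).
          by rewrite -expRD; congr expR; ring.
        by rewrite pdfE//; ring.
      rewrite [leRHS]EFinM lee_wpmul2r ?lee_fin ?normal_pdf_ge0//.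
      apply: le_trans (mle x xa); rewrite le_eqVlt; apply/orP; left; apply/eqP; congr (m _).
      by apply/seteqP; split => z; rewrite /xsection/= ?inE /A/= lerBlDl.
  rewrite ge0_integralZl//; first last.
  - by rewrite lee_fin mulr_ge0 ?expR_ge0 ?normal_peak_ge0.
  - by move=> x _; rewrite lee_fin.
  - exact/measurable_EFinP.
  rewrite (mulrA (decay (a ^+ 2))) [leRHS]EFinM; apply: lee_wpmul2l => //.
  by rewrite lee_fin mulr_ge0 ?expR_ge0 ?normal_peak_ge0.
apply: (@le_trans _ _ (gam (~` `[-a, a]%classic))).
  rewrite [leRHS]/normal_prob; apply: ge0_le_integral => //.
  - exact: measurableC.
  - exact: measurable_funTS.
  - by apply: measurable_funTS; apply/measurable_EFinP; exact: measurable_normal_pdf.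
  - move=> x _; rewrite -[leRHS]mul1e lee_wpmul2r ?lee_fin ?normal_pdf_ge0//.
    by apply: probability_le1; exact: measurable_xsection.
rewrite mulrC; apply: le_trans (normal_prob_tail sigma sigma_gt0 a a0).
apply: (@le_measure _ _ _ (normal_prob 0 sigma)); rewrite ?inE.
- exact: measurableC.
- by apply: (@measurable_superlevel R _ mR); exact: (@measurable_funX _ _ R _ _ 2).
- move=> x /=; rewrite in_itv/= => /negP; rewrite negb_and -!ltNge => /orP[] h; nra.
Qed.

Lemma continuous_asin_kernel (a : R) :
  {within `[-a, a], continuous (fun x : R => sigma / Num.sqrt (a ^+ 2 - x ^+ 2 + sigma ^+ 2 / 2))}.
Proof.
apply: continuous_in_subspaceT => x; rewrite inE/= in_itv/= => /andP[xa ax].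
have s2 : 0 < sigma ^+ 2 by rewrite exprn_gt0.
apply: cvgMl_tmp; apply: cvgV; first by rewrite gt_eqF// sqrtr_gt0; nra.
apply: continuous_comp; last exact: sqrt_continuous.
apply: cvgD; last exact: cvg_cst.
by apply: cvgB; [exact: cvg_cst|exact: exprn_continuous].
Qed.

(** The term sigma^2 / 2 makes [b] exceed [a], so the antiderivative sigma asin (x / b) is
    differentiable up to the endpoints. Its increment is at most sigma pi, and pi < 4. *)
Lemma integral_asin_le (a : R) : 0 < a ->
  (\int[mu]_(x in `[(- a)%R, a]) (sigma / Num.sqrt (a ^+ 2 - x ^+ 2 + sigma ^+ 2 / 2))%:E
    <= (4 * sigma)%:E)%E.
Proof.
move=> a0; pose b := Num.sqrt (a ^+ 2 + sigma ^+ 2 / 2).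
have s2 : 0 < sigma ^+ 2 / 2 by rewrite divr_gt0// exprn_gt0.
have a2 : 0 < a ^+ 2 by rewrite exprn_gt0.
have bE : b ^+ 2 = a ^+ 2 + sigma ^+ 2 / 2 by rewrite sqr_sqrtr// ltW// addr_gt0.
have b0 : 0 < b by rewrite sqrtr_gt0 addr_gt0.
have ab : a < b by nra.
pose F x := sigma * asin (x / b).
have itv1 (x : R) : -a <= x <= a -> -1 < x / b < 1.
  by move=> /andP[xa ax]; rewrite ltr_pdivlMr// ltr_pdivrMr// mulN1r mul1r; apply/andP; split; lra.
have pos (x : R) : -a <= x <= a -> 0 < a ^+ 2 - x ^+ 2 + sigma ^+ 2 / 2.
  by move=> /andP[xa ax]; nra.
have dF (x : R) : -a <= x <= a ->
    is_derive x 1 F (sigma / Num.sqrt (a ^+ 2 - x ^+ 2 + sigma ^+ 2 / 2)).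
  move=> xa; have dasin := is_derive1_asin (itv1 x xa).
  have dlin : is_derive x (1 : R) (fun x => x / b) b^-1.
    by apply: is_derive_eq; rewrite /GRing.scale/= mulr0 mulr1 add0r.
  have dcomp := is_derive1_comp (f := asin) (g := fun x => x / b) dasin dlin.
  have -> : F = sigma *: (asin \o (fun x => x / b)) by apply/funext.
  have e : Num.sqrt (a ^+ 2 - x ^+ 2 + sigma ^+ 2 / 2) = b * Num.sqrt (1 - (x / b) ^+ 2).
    rewrite -{1}(gtr0_norm b0) -sqrtr_sqr -sqrtrM ?sqr_ge0//; congr Num.sqrt.
    rewrite mulrBr mulr1 expr_div_n mulrCA divff ?mulr1 ?expf_neq0 ?gt_eqF// bE; ring.
  by rewrite e invfM; apply: is_derive_eq; rewrite /GRing.scale/= [_^-1 / b]mulrC.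
have Fcont (x : R) : -a <= x <= a -> {for x, continuous F}.
  move=> xa; have := dF x xa => ?.
  by apply: differentiable_continuous; apply/derivable1_diffP.
rewrite (@continuous_FTC2 R _ F); first last.
- move=> x; rewrite in_itv/= => /andP[xa ax].
  by rewrite derive1E; apply: derive_val; apply: dF; rewrite !ltW.
- split.
  + move=> x; rewrite in_itv/= => /andP[xa ax].
    have ? : is_derive x 1 F _ := dF x _; apply: ex_derive; apply: dF; rewrite !ltW//.
  + by apply: cvg_at_right_filter; apply: Fcont; rewrite lexx/=; lra.
  + by apply: cvg_at_left_filter; apply: Fcont; rewrite lexx andbT; lra.
- exact: continuous_asin_kernel.
- by lra.
rewrite -EFinB lee_fin /F -mulrBr mulrC ler_wpM2r ?(ltW sigma_gt0)//.
have wk (x : R) : -a <= x <= a -> -1 <= x / b <= 1.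
  by move=> /itv1/andP[h1 h2]; rewrite (ltW h1) (ltW h2).
have h1 : -1 <= a / b <= 1 by apply: wk; rewrite lexx andbT; lra.
have h2 : -1 <= -a / b <= 1 by apply: wk; rewrite lexx; lra.
have := asin_lepi2 h1; have := asin_geNpi2 h2; have := @pihalf_lt2 R.
by generalize (pi / 2 : R) => p; lra.
Qed.


(** Removes the singularity of sigma / sqrt s at s = 0. For s <= sigma^2 / 2 the bound exceeds 1,
    the factor 4 / 3 offsetting a decay of at least 3 / 4. For larger s, s + sigma^2 / 2 <= 2 s, and
    K^2 <= 16 / 25 leaves ample room. *)
Lemma normal_prob_tail_regularized (s : R) : 0 <= s ->
  (gam [set x | (s <= x ^+ 2)%R] <=
    (decay s * (4 / 3 * (sigma / Num.sqrt (s + sigma ^+ 2 / 2))))%:E)%E.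
Proof.
move=> s0; have s2 : 0 < sigma ^+ 2 by rewrite exprn_gt0.
have q0 : 0 < Num.sqrt (s + sigma ^+ 2 / 2) by rewrite sqrtr_gt0; lra.
have mA : measurable ([set x | s <= x ^+ 2] : set mR).
  by apply: (@measurable_superlevel R _ mR); exact: (@measurable_funX _ _ R _ _ 2).
have [s_small|s_big] := leP s (sigma ^+ 2 / 2).
  apply: le_trans (probability_le1 (normal_prob 0 sigma) mA) _; rewrite lee_fin.
  have d34 : 3 / 4 <= decay s.
    apply: le_trans (expR_ge1Dx _).
    suff : s / (2 * sigma ^+ 2) <= 1 / 4 by rewrite mulNr; lra.
    by rewrite ler_pdivrMr ?mulr_gt0//; lra.
  have q1 : 1 <= sigma / Num.sqrt (s + sigma ^+ 2 / 2).
    rewrite ler_pdivlMr// mul1r -{2}(gtr0_norm sigma_gt0) -sqrtr_sqr ler_sqrt; lra.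
  rewrite -[leLHS](_ : 3 / 4 * (4 / 3 * 1) = 1); last by field.
  by rewrite ler_pM// ler_wpM2l.
have sq0 : 0 < Num.sqrt s by rewrite sqrtr_gt0; lra.
have := normal_prob_tail sigma sigma_gt0 (Num.sqrt s) sq0; rewrite sqr_sqrtr// => /le_trans; apply.
rewrite lee_fin mulrC ler_pM2l ?expR_gt0// mulrCA [leRHS]mulrCA ler_pM2l//.
rewrite ler_pdivlMr// mulrAC ler_pdivrMr//.
have KK := two_peak_lt sigma sigma_gt0; have K0 := two_peak_gt0 sigma sigma_gt0.
move: (two_peak sigma) KK K0 => k KK K0.
rewrite -(@ler_pXn2r _ 2) ?nnegrE ?mulr_ge0 ?(ltW K0) ?(ltW q0) ?(ltW sq0)//.
rewrite !exprMn !sqr_sqrtr//; last by lra.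
have k2 : k ^+ 2 <= 16 / 25 by nra.
apply: (@le_trans _ _ (16 / 25 * (s + sigma ^+ 2 / 2))); first by rewrite ler_wpM2r//; lra.
by rewrite exprVn; lra.
Qed.

(** The maximum with 1 extends the bound to every real s, as the induction needs: conditioning on
    one variable lowers the remaining threshold to any value down to 0. *)
Definition chi_bound (n : nat) (s : R) : R :=
  K * n%:R ^+ 2 * Num.max 1 (s / sigma ^+ 2) `^ (n%:R / 2 - 1) * decay s.

(** Below sigma^2 the bound is trivial for a probability: K >= 1 / 2, n^2 >= 4 and a decay of at
    least 1 / 2 multiply to at least 1. *)
Lemma chi_bound_ge1 n s : (2 <= n)%N -> s <= sigma ^+ 2 -> 1 <= chi_bound n s.
Proof.
move=> n2 ss; have s2 : 0 < sigma ^+ 2 by rewrite exprn_gt0.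
have t1 : s / sigma ^+ 2 <= 1 by rewrite ler_pdivrMr// mul1r.
rewrite /chi_bound max_l// powR1 mulr1.
have d12 : 1 / 2 <= decay s.
  apply: le_trans (expR_ge1Dx _).
  suff : s / (2 * sigma ^+ 2) <= 1 / 2 by rewrite mulNr; lra.
  by rewrite ler_pdivrMr ?mulr_gt0//; lra.
have KK := two_peak_ge sigma sigma_gt0.
have nn : 4 <= n%:R ^+ 2 :> R by rewrite -natrX ler_nat (leq_exp2r 2 n (e := 2)).
rewrite -[leLHS](_ : 1 / 2 * 4 * (1 / 2) = 1); last by field.
have half0 : 0 <= 1 / 2 :> R by lra.
by apply: ler_pM => //; exact: ler_pM.
Qed.

Lemma chi_bound_big n s : sigma ^+ 2 <= s ->
  chi_bound n s = K * n%:R ^+ 2 * (s / sigma ^+ 2) `^ (n%:R / 2 - 1) * decay s.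
Proof.
by move=> ss; rewrite /chi_bound max_r// ler_pdivlMr ?exprn_gt0// mul1r.
Qed.

(** The irregular step: [m] is the law of one squared normal variable, whose tail factor is
    unbounded near 0 until regularized. *)
Lemma sqr_plus_chi_bound2 (m : probability mR R) :
  (forall s : R, m [set z | (s <= z)%R] = gam [set x | (s <= x ^+ 2)%R]) ->
  forall s : R, ((gam \x m) [set z | (s <= z.1 ^+ 2 + z.2)%R] <= (chi_bound 2 s)%:E)%E.
Proof.
move=> mE s; have s2 : 0 < sigma ^+ 2 by rewrite exprn_gt0.
have [ss|ss] := leP s (sigma ^+ 2).
  apply: (le_trans (probability_le1 (gam \x m)%E (measurable_sqr_plus_tail s))).
  by rewrite lee_fin chi_bound_ge1.
have sge0 : 0 <= s by lra.
pose a := Num.sqrt s; have a2 : a ^+ 2 = s by rewrite sqr_sqrtr.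
have a0 : 0 < a by rewrite sqrtr_gt0; lra.
have sa : sigma <= a.
  by rewrite -(@ler_pXn2r _ 2) ?nnegrE ?(ltW sigma_gt0) ?(ltW a0)// a2 ltW.
have mk : measurable_fun `[-a, a]
    (fun x : R => sigma / Num.sqrt (a ^+ 2 - x ^+ 2 + sigma ^+ 2 / 2)).
  apply: subspace_continuous_measurable_fun; first exact: measurable_itv.
  exact: continuous_asin_kernel.
have mg : measurable_fun `[-a, a]
    (fun x : R => 4 / 3 * (sigma / Num.sqrt (a ^+ 2 - x ^+ 2 + sigma ^+ 2 / 2))).
  by apply: measurable_funM.
have := sqr_plus_tail_le m a (4 / 3 * (4 * sigma))
  (fun x => 4 / 3 * (sigma / Num.sqrt (a ^+ 2 - x ^+ 2 + sigma ^+ 2 / 2))) a0 mg.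
rewrite a2 => h; apply: (le_trans (h _ _ _)).
- by move=> x; rewrite mulr_ge0// divr_ge0// ?(ltW sigma_gt0) ?sqrtr_ge0.
- rewrite -a2; under eq_integral do rewrite EFinM.
  rewrite ge0_integralZl//.
  + by rewrite [leRHS]EFinM; apply: lee_wpmul2l; [rewrite lee_fin|exact: integral_asin_le].
  + exact/measurable_EFinP.
  + by move=> x _; rewrite lee_fin divr_ge0// ?(ltW sigma_gt0) ?sqrtr_ge0.
- move=> x /andP[xa ax]; rewrite -a2 mE; apply: normal_prob_tail_regularized.
  by nra.
rewrite lee_fin chi_bound_big ?(ltW ss)// divff// subrr powRr0 mulr1 mulrC.
rewrite ler_pM2r ?expR_gt0//.
(* Together with sigma / a <= 1 the total is at most K (1 + 8 / 3), below the allowed 4 K. *)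
have -> : normal_peak sigma * (4 / 3 * (4 * sigma)) = K * (8 / 3).
  by rewrite /two_peak; ring.
have : sigma / a <= 1 by rewrite ler_pdivrMr// mul1r.
have := two_peak_gt0 sigma sigma_gt0; move: (sigma / a) K => u k; nra.
Qed.

(** As n / 2 - 1 >= 0, the power factor is largest at x = 0 and can be taken constant on [-a, a].
    The interval length 2 a supplies the missing half power of t, and (1 + n^2) <= (n + 1)^2 absorbs
    the boundary term. *)
Lemma sqr_plus_chi_bound (m : probability mR R) n : (2 <= n)%N ->
  (forall s : R, (m [set z | (s <= z)%R] <= (chi_bound n s)%:E)%E) ->
  forall s : R, ((gam \x m) [set z | (s <= z.1 ^+ 2 + z.2)%R] <= (chi_bound n.+1 s)%:E)%E.
Proof.
move=> n2 mle s; have s2 : 0 < sigma ^+ 2 by rewrite exprn_gt0.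
have [ss|ss] := leP s (sigma ^+ 2).
  apply: (le_trans (probability_le1 (gam \x m)%E (measurable_sqr_plus_tail s))).
  by rewrite lee_fin chi_bound_ge1// ltnW.
have sge0 : 0 <= s by lra.
pose a := Num.sqrt s; have a2 : a ^+ 2 = s by rewrite sqr_sqrtr.
have a0 : 0 < a by rewrite sqrtr_gt0; lra.
have sa : sigma <= a.
  by rewrite -(@ler_pXn2r _ 2) ?nnegrE ?(ltW sigma_gt0) ?(ltW a0)// a2 ltW.
have K0 := two_peak_gt0 sigma sigma_gt0.
pose t := s / sigma ^+ 2.
have t1 : 1 <= t by rewrite ler_pdivlMr// mul1r ltW.
have n2R : 2 <= n%:R :> R by rewrite ler_nat.
have n1 : 0 <= n%:R / 2 - 1 :> R by lra.
pose c := K * n%:R ^+ 2 * t `^ (n%:R / 2 - 1).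
have Kn0 : 0 <= K * n%:R ^+ 2 by apply: mulr_ge0; [exact: ltW|exact: sqr_ge0].
have c0 : 0 <= c by rewrite mulr_ge0 ?powR_ge0// mulr_ge0 ?(ltW K0)// sqr_ge0.
have := sqr_plus_tail_le m a (2 * a * c) (fun=> c) a0 (measurable_cst _) (fun=> c0).
rewrite a2 => h; apply: (le_trans (h _ _)).
- rewrite integral_cst//=.
  rewrite lebesgue_measure_itv/= lte_fin ifT; last by lra.
  by rewrite -EFinB -EFinM lee_fin; nra.
- move=> x xa; apply: (le_trans (mle _)); rewrite lee_fin /chi_bound mulrC.
  rewrite ler_pM2l ?expR_gt0// /c ler_wpM2l//.
  apply: ge0_ler_powR => //; rewrite ?nnegrE; [by rewrite le_max ler01|lra|].
  rewrite ge_max t1/= ler_pM2r ?invr_gt0//; have := sqr_ge0 x; lra.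
rewrite lee_fin chi_bound_big ?(ltW ss)// mulrC ler_pM2r ?expR_gt0// -/t.
have tq : t = (a / sigma) ^+ 2 by rewrite /t -a2 expr_div_n.
have as1 : 1 <= a / sigma by rewrite ler_pdivlMr// mul1r.
have nS : n.+1%:R = n%:R + 1 :> R by rewrite -natr1.
pose q := t `^ (n.+1%:R / 2 - 1).
have qE : q = a / sigma * t `^ (n%:R / 2 - 1).
  rewrite /q nS (_ : (_ + 1) / 2 - 1 = 2^-1 + (n%:R / 2 - 1)); last by field.
  rewrite powRD; last by apply/implyP => _; rewrite gt_eqF//; lra.
  by rewrite powR12_sqrt ?tq ?sqr_ge0// sqrtr_sqr ger0_norm//; lra.
have q1 : 1 <= q.
  by rewrite -[leLHS](powRr0 t); apply: ler_powR => //; rewrite nS; lra.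
have -> : normal_peak sigma * (2 * a * c) = K * (K * n%:R ^+ 2) * q.
  by rewrite qE /c /two_peak; field; rewrite gt_eqF.
have sa1 : sigma / a <= 1 by rewrite ler_pdivrMr// mul1r.
have K1 : K <= 1 by have := two_peak_lt sigma sigma_gt0; lra.
rewrite -/q -mulrA -mulrDr -[leRHS]mulrA ler_pM2l//.
apply: (@le_trans _ _ ((1 + n%:R ^+ 2) * q)).
  rewrite mulrDl mul1r lerD ?(le_trans sa1)// ler_wpM2r//; first by lra.
  by rewrite -[leRHS]mul1r ler_wpM2r.
rewrite ler_wpM2r//; first by lra.
by rewrite nS; nra.
Qed.

End TailRec.

(** * Partial sums of squares of independent variables *)

Section ChiSquare.
Context {R : realType} {dT : measure_display} {T : measurableType dT} (P : probability T R).
Variables (L : nat) (w : 'I_L -> T -> R).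
Local Notation mR := (measurableTypeR R).

Definition sum_sqr (n : nat) (t : T) : R := \sum_(l < L | (l < n)%N) w l t ^+ 2.

(* Coordinate 0 collects the first n squares, the other consumed coordinates become 0. *)
Definition gather_sqr (n : nat) (l : 'I_L) (t : T) : R :=
  if l == 0 :> nat then sum_sqr n t else if (l < n)%N then 0 else w l t.

Hypothesis mw : forall l, measurable_fun setT (w l).
Hypothesis indw : mutually_independent P w.

Lemma measurable_sum_sqr n : measurable_fun setT (sum_sqr n).
Proof.
rewrite (_ : sum_sqr n = fun t => \sum_(l < L) (if (l < n)%N then w l t ^+ 2 else 0)).
  apply: measurable_sum => l; case: (l < n)%N => //.
  exact: measurable_funX.
by apply/funext => t; rewrite /sum_sqr big_mkcond.
Qed.

Lemma sum_sqrS (j : 'I_L) t : sum_sqr j.+1 t = w j t ^+ 2 + sum_sqr j t.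
Proof.
rewrite /sum_sqr (bigD1 j)//=; congr (_ + _); apply: eq_bigl => l.
by rewrite ltnS ltn_neqAle andbC -(inj_eq val_inj).
Qed.

Lemma measurable_gather_sqr n l : measurable_fun setT (gather_sqr n l).
Proof.
rewrite /gather_sqr; case: (_ == _); first exact: measurable_sum_sqr.
by case: (_ < _)%N.
Qed.

(** Each new square is absorbed by one [replace_pair]: coordinate 0 takes the larger sum and the
    consumed coordinate becomes the constant 0, which is independent of everything. Keeping all L
    coordinates leaves the index type fixed. *)
Lemma indep_gather_sqr n : (0 < n <= L)%N -> mutually_independent P (gather_sqr n).
Proof.
move=> /andP[n0 nL]; have L0 := leq_trans n0 nL.
pose i0 : 'I_L := Ordinal L0.
elim: n n0 nL => // -[_ _ _|n IHn _ nL].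
  move=> B mB.
  pose B' (l : 'I_L) : set R := (fun x => if l == i0 then x ^+ 2 else x) @^-1` B l.
  have mB' l : measurable (B' l).
    apply: (@measurable_preimageT _ _ mR mR); last exact: mB.
    by case: (l == i0) => //; exact: (@measurable_funX _ _ R _ _ 2).
  have E l : gather_sqr 1 l @^-1` B l = w l @^-1` B' l.
    suff -> : gather_sqr 1 l = fun t => if l == i0 then w l t ^+ 2 else w l t by [].
    apply/funext => t; rewrite /gather_sqr -(inj_eq val_inj) /=.
    have [l0|l0] := eqVneq (l : nat) 0%N; last by rewrite ltnS leqn0 (negbTE l0).
    rewrite /sum_sqr (big_pred1 l)// => l'.
    by rewrite ltnS leqn0 -l0 /= -(inj_eq val_inj).
  transitivity (P (\bigcap_(j in [set: 'I_L]) (w j @^-1` B' j))).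
    by congr (P _); apply: eq_bigcapr => l _; exact: E.
  by rewrite indw//; apply: eq_bigr => l _; rewrite E.
have {}IHn := IHn isT (ltnW nL).
pose j : 'I_L := Ordinal nL.
have ij : i0 != j by apply/eqP => /(congr1 val).
pose f (z : R * R) := z.2 ^+ 2 + z.1.
have mf : measurable_fun setT f.
  by apply: measurable_funD => //; apply: measurable_funX.
have E : gather_sqr n.+2 = replace_pair i0 j f (cst 0) (gather_sqr n.+1).
  apply/funext => l; apply/funext => t.
  rewrite /replace_pair {1}/gather_sqr -!(inj_eq val_inj) /=.
  case: eqVneq => [l0|l0].
    by rewrite /f /gather_sqr /= ltnn (sum_sqrS j).
  case: eqVneq => [->|ln]; first by rewrite ltnSn.
  rewrite /gather_sqr (negbTE l0) ltnS leq_eqVlt (negbTE ln) /=; by [].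
rewrite E; apply: indep_replace_pair => //.
- exact: measurable_gather_sqr.
- move=> A B mA mB.
  rewrite [(fun _ => cst 0 _) @^-1` B](_ : _ = if 0 \in B then setT else set0); last first.
    by rewrite -preimage_cst.
  by case: ifP => _; rewrite ?setIT ?setI0 ?probability_setT ?measure0 ?mule1 ?mule0.
Qed.

End ChiSquare.

Section ChiSquareTail.
Context {R : realType} {dT : measure_display} {T : measurableType dT} (P : probability T R).
Variables (sigma : R) (sigma_gt0 : 0 < sigma).
Local Notation mR := (measurableTypeR R).

(** The next variable is independent of the partial sum, so their joint law is a product and [m] is
    the law of that sum. The bound [b'] is left free so that the steps from 1 to 2 and from n to n +
    1 share this argument. *)
Lemma sum_sqr_tail_rec L (w : 'I_L -> T -> R) n (b' : R -> R) :
  iid_normal P sigma w -> (0 < n < L)%N ->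
  (forall m : probability mR R,
    (forall s, m [set z | (s <= z)%R] = P [set t | (s <= sum_sqr L w n t)%R]) ->
    forall s : R, ((normal_prob 0 sigma \x m) [set z | (s <= z.1 ^+ 2 + z.2)%R] <= (b' s)%:E)%E) ->
  forall s : R, (P [set t | (s <= sum_sqr L w n.+1 t)%R] <= (b' s)%:E)%E.
Proof.
move=> [mw indw laww] /andP[n0 nL] step s.
pose i0 : 'I_L := Ordinal (leq_ltn_trans (leq0n n) nL).
pose j : 'I_L := Ordinal nL.
have ji : j != i0 by apply/eqP => /(congr1 val)/= ?; lia.
have mZ : @measurable_fun _ _ T mR setT (sum_sqr L w n) by exact: measurable_sum_sqr.
pose Z : {mfun T >-> mR} := HB.pack (sum_sqr L w n) (isMeasurableFun.Build _ _ _ _ _ mZ).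
pose m : probability mR R := distribution P Z.
have := step m (fun s => erefl) s; congr (_ <= _)%E.
rewrite -(@indep_pair_law _ _ _ P _ (gather_sqr L w n) j i0 (normal_prob 0 sigma) m).
- congr (P _); apply/seteqP; split => t /=;
    by rewrite (sum_sqrS L w j) /gather_sqr /= ltnn (gtn_eqF n0).
- exact: measurable_gather_sqr.
- by apply: indep_gather_sqr => //; rewrite n0 ltnW.
- by [].
- by move=> B mB; rewrite /gather_sqr /= (gtn_eqF n0) ltnn laww.
- by [].
- exact: measurable_sqr_plus_tail.
Qed.

Lemma sum_sqr_tail L (w : 'I_L -> T -> R) n (s : R) :
  iid_normal P sigma w -> (0 < n <= L)%N -> sigma ^+ 2 <= s ->
  (P [set t | (s <= sum_sqr L w n t)%R] <=
    (two_peak sigma * n%:R ^+ 2 * (s / sigma ^+ 2) `^ (n%:R / 2 - 1) *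
     expR (- s / (2 * sigma ^+ 2)))%:E)%E.
Proof.
move=> iidw /andP[n0 nL] ss.
have [mw indw laww] := iidw.
have s2 : 0 < sigma ^+ 2 by rewrite exprn_gt0.
have one (r : R) (L0 : (0 < L)%N) : P [set t | (r <= sum_sqr L w 1 t)%R] =
    normal_prob 0 sigma [set x | (r <= x ^+ 2)%R].
  have mS : measurable ([set x | r <= x ^+ 2] : set R).
    by apply: measurable_superlevel; exact: measurable_funX.
  rewrite -(laww (Ordinal L0))//; congr (P _).
  have E t : sum_sqr L w 1 t = w (Ordinal L0) t ^+ 2.
    by rewrite (sum_sqrS L w (Ordinal L0)) /sum_sqr big_pred0 ?addr0// => l; rewrite ltn0.
  by apply/seteqP; split => t /=; rewrite E.
have [n1|n2] := leqP n 1.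
  (* A single square is handled apart: sigma / a is exactly t^(-1/2), and [chi_bound] exceeds 1
     below sigma^2 only from n = 2 on. *)
  have -> : n = 1%N by lia.
  rewrite one; last exact: leq_trans nL.
  pose a := Num.sqrt s.
  have sge0 : 0 <= s by rewrite (le_trans _ ss)// ltW.
  have a2 : a ^+ 2 = s by rewrite sqr_sqrtr.
  have a0 : 0 < a by rewrite sqrtr_gt0 (lt_le_trans _ ss).
  have := normal_prob_tail sigma sigma_gt0 a a0; rewrite a2 => /le_trans; apply.
  rewrite lee_fin ler_pM2r ?expR_gt0// expr1n mulr1 ler_pM2l ?two_peak_gt0//.
  have -> : 1 / 2 - 1 = - 2^-1 :> R by field.
  rewrite powRN powR12_sqrt ?divr_ge0 ?(ltW s2)// sqrtrM// sqrtrV ?(ltW s2)//.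
  by rewrite sqrtr_sqr gtr0_norm// invfM invrK mulrC.
(* Switching to [chi_bound] frees the induction from the restriction sigma^2 <= s. *)
rewrite -chi_bound_big//; elim: n {n0} n2 nL s {ss} => // n IHn n2 nL s.
have [n1|{}n2] := leqP n 1.
  have nE : n = 1%N by lia.
  subst n.
  apply: (@sum_sqr_tail_rec L w 1) => // m mE r.
  by apply: sqr_plus_chi_bound2 => // r'; rewrite mE (one _ (ltnW nL)).
apply: (@sum_sqr_tail_rec L w n) => //; first by lia.
move=> m mE r; apply: sqr_plus_chi_bound => // r'.
by rewrite mE IHn// ltnW.
Qed.

End ChiSquareTail.

(** * Euclidean norms *)

Section Norm2.
Context {R : realType}.

Lemma cauchy_schwarz_sum (I : finType) (a b : I -> R) :
  (\sum_i a i * b i) ^+ 2 <= (\sum_i a i ^+ 2) * (\sum_i b i ^+ 2).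
Proof.
set A := \sum_i a i ^+ 2; set B := \sum_i b i ^+ 2; set C := \sum_i a i * b i.
have B0 : 0 <= B by apply: sumr_ge0 => i _; exact: sqr_ge0.
have [Bz|Bn] := eqVneq B 0.
  have b0 i : b i = 0.
    apply/eqP; rewrite -sqrf_eq0; apply/eqP.
    by have /psumr_eq0P := Bz; apply => // j _; exact: sqr_ge0.
  by rewrite /C big1 ?expr0n/= ?Bz ?mulr0// => i _; rewrite b0 mulr0.
have Bp : 0 < B by rewrite lt_def Bn.
have : 0 <= \sum_i (B * a i - C * b i) ^+ 2 by apply: sumr_ge0 => i _; exact: sqr_ge0.
have -> : \sum_i (B * a i - C * b i) ^+ 2 = B * (A * B - C ^+ 2).
  transitivity (\sum_i (B ^+ 2 * a i ^+ 2 - 2 * B * C * (a i * b i) + C ^+ 2 * b i ^+ 2)).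
    by apply: eq_bigr => i _; ring.
  by rewrite big_split/= sumrB -!mulr_sumr -/A -/B -/C; ring.
by rewrite pmulr_rge0// subr_ge0.
Qed.

Definition dotcv n (u v : 'cV[R]_n) : R := (u^T *m v) 0 0.

Lemma dotcvE n (u v : 'cV[R]_n) : dotcv n u v = \sum_i u i 0 * v i 0.
Proof. by rewrite /dotcv !mxE; apply: eq_bigr => i _; rewrite !mxE. Qed.

Lemma norm2_ge0 n (v : 'cV[R]_n) : 0 <= norm2 v.
Proof. exact: sqrtr_ge0. Qed.

Lemma norm2_sqr n (v : 'cV[R]_n) : norm2 v ^+ 2 = \sum_i v i 0 ^+ 2.
Proof. by rewrite sqr_sqrtr// sumr_ge0// => i _; exact: sqr_ge0. Qed.

Lemma norm2_dot n (v : 'cV[R]_n) : norm2 v ^+ 2 = dotcv n v v.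
Proof. by rewrite norm2_sqr dotcvE; apply: eq_bigr => i _; rewrite expr2. Qed.

Lemma dotcv_le n (u v : 'cV[R]_n) : `|dotcv n u v| <= norm2 u * norm2 v.
Proof.
rewrite -(@ler_pXn2r _ 2) ?nnegrE ?mulr_ge0 ?norm2_ge0//.
rewrite real_normK ?num_real// exprMn !norm2_sqr dotcvE.
exact: cauchy_schwarz_sum.
Qed.

Lemma dotcvD n (u v z : 'cV[R]_n) : dotcv n u (v + z) = dotcv n u v + dotcv n u z.
Proof. by rewrite /dotcv mulmxDr mxE. Qed.

Lemma dotcvC n (u v : 'cV[R]_n) : dotcv n u v = dotcv n v u.
Proof. by rewrite !dotcvE; apply: eq_bigr => i _; rewrite mulrC. Qed.

Lemma dotcv_sumr n (I : finType) (p : pred I) (u : 'cV[R]_n) (v : I -> 'cV[R]_n) :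
  dotcv n u (\sum_(i | p i) v i) = \sum_(i | p i) dotcv n u (v i).
Proof. by rewrite /dotcv mulmx_sumr summxE. Qed.

Lemma dotcv_tr m n (A : 'M[R]_(m, n)) (u : 'cV[R]_m) (v : 'cV[R]_n) :
  dotcv n (A^T *m u) v = dotcv m u (A *m v).
Proof. by rewrite /dotcv trmx_mul trmxK mulmxA. Qed.

Lemma norm2D n (u v : 'cV[R]_n) : norm2 (u + v) <= norm2 u + norm2 v.
Proof.
rewrite -(@ler_pXn2r _ 2) ?nnegrE ?addr_ge0 ?norm2_ge0//.
rewrite norm2_dot dotcvD !(dotcvC _ (u + v)) !dotcvD -!norm2_dot (dotcvC _ v u).
have := dotcv_le _ u v; rewrite ler_norml => /andP[_ h].
by rewrite sqrrD; lra.
Qed.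

Lemma norm20 n : norm2 (0 : 'cV[R]_n) = 0.
Proof. by rewrite /norm2 big1 ?sqrtr0// => i _; rewrite mxE expr0n. Qed.

Lemma norm2N n (u : 'cV[R]_n) : norm2 (- u) = norm2 u.
Proof. by congr Num.sqrt; apply: eq_bigr => i _; rewrite mxE sqrrN. Qed.

Lemma norm2Z n (a : R) (u : 'cV[R]_n) : norm2 (a *: u) = `|a| * norm2 u.
Proof.
rewrite /norm2 -sqrtr_sqr -sqrtrM ?sqr_ge0// mulr_sumr; congr Num.sqrt.
by apply: eq_bigr => i _; rewrite mxE exprMn.
Qed.

Lemma norm2_eq0 n (u : 'cV[R]_n) : (norm2 u == 0) = (u == 0).
Proof.
apply/eqP/eqP => [u0|->]; last exact: norm20.
apply/colP => i; rewrite mxE; apply/eqP; rewrite -sqrf_eq0; apply/eqP.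
have /psumr_eq0P : \sum_i u i 0 ^+ 2 = 0 by rewrite -norm2_sqr u0 expr0n.
by apply => // j _; exact: sqr_ge0.
Qed.

Lemma norm2_sum n (I : finType) (p : pred I) (v : I -> 'cV[R]_n) :
  norm2 (\sum_(i | p i) v i) <= \sum_(i | p i) norm2 (v i).
Proof.
elim/big_rec2: _ => [|i x u _ le]; first by rewrite norm20.
by apply: le_trans (norm2D _ _ _) _; rewrite lerD2l.
Qed.

Lemma norm2B_ge n (u v : 'cV[R]_n) : norm2 u - norm2 v <= norm2 (u + v).
Proof.
rewrite lerBlDr -{1}(addrK v u).
by apply: le_trans (norm2D _ _ _) _; rewrite norm2N.
Qed.

(** Shows that the set defining [opnorm] is bounded, without which its supremum would not be an
    upper bound. *)
Lemma norm2_mulmx_frob m n (A : 'M[R]_(m, n)) (v : 'cV[R]_n) :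
  norm2 (A *m v) <= Num.sqrt (\sum_i \sum_j A i j ^+ 2) * norm2 v.
Proof.
rewrite /norm2 -sqrtrM; last by do 2 (apply: sumr_ge0 => ? _); exact: sqr_ge0.
rewrite ler_wsqrtr// mulr_suml; apply: ler_sum => i _.
rewrite mxE; exact: cauchy_schwarz_sum.
Qed.

Lemma norm2_mulmx_opnorm m n (A : 'M[R]_(m, n)) (v : 'cV[R]_n) :
  norm2 (A *m v) <= opnorm A * norm2 v.
Proof.
have [->|v0] := eqVneq v 0; first by rewrite mulmx0 !norm20 mulr0.
have nv : 0 < norm2 v by rewrite lt_def norm2_eq0 v0 norm2_ge0.
rewrite -ler_pdivrMr//.
have -> : norm2 (A *m v) / norm2 v = norm2 (A *m ((norm2 v)^-1 *: v)).
  by rewrite -scalemxAr norm2Z ger0_norm ?invr_ge0 ?norm2_ge0// mulrC.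
apply: ub_le_sup.
  exists (Num.sqrt (\sum_i \sum_j A i j ^+ 2)) => _ [u /= u1 <-].
  by apply: le_trans (norm2_mulmx_frob _ _ _ _) _; rewrite u1 mulr1.
exists ((norm2 v)^-1 *: v) => //=.
by rewrite norm2Z ger0_norm ?invr_ge0 ?norm2_ge0// mulVf// gt_eqF.
Qed.

End Norm2.

(** * Tail of a linear image of the noise *)

Section NormalImage.
Context {R : realType} {dT : measure_display} {T : measurableType dT} (P : probability T R).
Variables (sigma : R) (sigma_gt0 : 0 < sigma).

Lemma measurable_norm2_sqr_image d L (A : 'M[R]_(d, L)) (w : 'I_L -> T -> R) :
  (forall l, measurable_fun setT (w l)) ->
  measurable_fun setT (fun t => norm2 (A *m \col_j w j t) ^+ 2).
Proof.
move=> mw.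
rewrite (_ : (fun _ => _) = fun t => \sum_r (\sum_l A r l * w l t) ^+ 2).
  apply: measurable_sum => r; apply: measurable_funX.
  by apply: measurable_sum => l; exact: measurable_funM.
apply/funext => t; rewrite norm2_sqr; apply: eq_bigr => r _.
by rewrite mxE; congr (_ ^+ 2); apply: eq_bigr => l _; rewrite mxE.
Qed.

(** After triangularization the image is y = A' v, with [v] the first d noise coordinates. Put z =
    A'^T y: then |y|^2 = z . v and |z|^2 <= lam |y|^2, so Cauchy-Schwarz gives |y|^2 <= lam |v|^2.
    No comparison of the norms of a matrix and its transpose is needed. *)
Lemma normal_image_tail d L (A : 'M[R]_(d, L)) (w : 'I_L -> T -> R) (lam s : R) :
  iid_normal P sigma w -> (0 < d <= L)%N -> 0 < lam -> sigma ^+ 2 <= s ->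
  (forall u : 'cV[R]_d, norm2 (A^T *m u) ^+ 2 <= lam * norm2 u ^+ 2) ->
  (P [set t | (lam * s <= norm2 (A *m \col_j w j t) ^+ 2)%R] <=
    (two_peak sigma * d%:R ^+ 2 * (s / sigma ^+ 2) `^ (d%:R / 2 - 1) *
     expR (- s / (2 * sigma ^+ 2)))%:E)%E.
Proof.
move=> iidw dL lam0 ss Alam.
have sigma0 : sigma != 0 by rewrite gt_eqF.
have [A' [w' [iidw' A'w' A'A' A'0]]] :=
  iid_normal_triangularize P sigma d L (fun r l => A r l) w sigma0 iidw.
apply: le_trans (sum_sqr_tail P sigma sigma_gt0 L w' d s iidw' dL ss).
have [mw _ _] := iidw; have [mw' _ _] := iidw'.
apply: le_measure; rewrite ?inE; first by apply: measurable_superlevel; exact: measurable_norm2_sqr_image.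
  by apply: measurable_superlevel; exact: measurable_sum_sqr.
move=> t /= le_s.
pose y := A *m \col_j w j t.
pose v (l : 'I_L) := if (l < d)%N then w' l t else 0.
have yE r : y r 0 = \sum_l A' r l * v l.
  rewrite mxE; transitivity (\sum_l A r l * w l t).
    by apply: eq_bigr => l _; rewrite mxE.
  rewrite -A'w'; apply: eq_bigr => l _; rewrite /v; case: ltnP => // dl.
  by rewrite A'0 ?mul0r// (leq_trans _ dl).
pose z l := \sum_r A' r l * y r 0.
have zz : \sum_l z l ^+ 2 <= lam * norm2 y ^+ 2.
  apply: le_trans (Alam y); rewrite norm2_sqr le_eqVlt; apply/orP; left; apply/eqP.
  (* |B^T y|^2 depends on B only through B B^T, which triangularization preserves; this moves the
     hypothesis from [A] to [A']. *)
  have gram (B : 'I_d -> 'I_L -> R) : \sum_l (\sum_r B r l * y r 0) ^+ 2 =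
      \sum_r \sum_r' y r 0 * y r' 0 * \sum_l B r l * B r' l.
    transitivity (\sum_l \sum_r \sum_r' (B r l * y r 0) * (B r' l * y r' 0)).
      apply: eq_bigr => l _; rewrite expr2 mulr_suml; apply: eq_bigr => r _.
      by rewrite mulr_sumr.
    rewrite exchange_big; apply: eq_bigr => r _.
    rewrite exchange_big; apply: eq_bigr => r' _.
    by rewrite mulr_sumr; apply: eq_bigr => l _; ring.
  transitivity (\sum_l (\sum_r A r l * y r 0) ^+ 2); last first.
    apply: eq_bigr => l _; rewrite mxE; congr (_ ^+ 2).
    by apply: eq_bigr => r _; rewrite [A^T _ _]mxE.
  rewrite /z !gram; apply: eq_bigr => r _; apply: eq_bigr => r' _.
  by rewrite A'A'.
have yy : norm2 y ^+ 2 = \sum_l z l * v l.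
  rewrite norm2_sqr; transitivity (\sum_r \sum_l y r 0 * (A' r l * v l)).
    by apply: eq_bigr => r _; rewrite expr2 {2}yE mulr_sumr.
  rewrite exchange_big; apply: eq_bigr => l _; rewrite /z mulr_suml.
  by apply: eq_bigr => r _; ring.
have vv : \sum_l v l ^+ 2 = sum_sqr L w' d t.
  rewrite /sum_sqr [RHS]big_mkcond; apply: eq_bigr => l _.
  by rewrite /v; case: ifP => // _; rewrite expr0n.
have cs := cauchy_schwarz_sum _ z v; rewrite -yy vv in cs.
have Y0 : 0 <= norm2 y ^+ 2 by exact: sqr_ge0.
have S0 : 0 <= sum_sqr L w' d t by rewrite -vv sumr_ge0// => l _; exact: sqr_ge0.
have s0 : 0 < s by rewrite (lt_le_trans _ ss)// exprn_gt0.
have Yp : 0 < norm2 y ^+ 2 by rewrite (lt_le_trans _ le_s)// mulr_gt0.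
rewrite -(ler_pM2l lam0); apply: (le_trans le_s); rewrite -/y.
rewrite -(ler_pM2l Yp) -expr2; apply: (le_trans cs).
by rewrite mulrA (mulrC (norm2 y ^+ 2)) ler_wpM2r.
Qed.

End NormalImage.

(** * Block coherence *)

Section Blocks.
Context {R : realType}.

Lemma sum_blkidx (V : nmodType) (M d : nat) (F : 'I_(M * d) -> V) :
  \sum_j F j = \sum_(i < M) \sum_(t < d) F (blkidx i t).
Proof.
have modlt (j : 'I_(M * d)) : (j %% d < d)%N.
  by rewrite ltn_pmod//; have := leq_ltn_trans (leq0n _) (ltn_ord j); rewrite muln_gt0 => /andP[].
have divlt (j : 'I_(M * d)) : (j %/ d < M)%N.
  by rewrite ltn_divLR ?ltn_ord// (leq_ltn_trans _ (modlt j)).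
rewrite pair_big/= (reindex (fun p : 'I_M * 'I_d => blkidx p.1 p.2))//=.
exists (fun j => (Ordinal (divlt j), Ordinal (modlt j))) => [[i t] _|j _].
  have d0 : (0 < d)%N by rewrite (leq_ltn_trans _ (ltn_ord t)).
  congr pair; apply: val_inj => /=.
    by rewrite divnMDl// divn_small ?addn0.
  by rewrite modnMDl modn_small.
by apply: val_inj; rewrite /= -divn_eq.
Qed.

Lemma mulmx_blocks (L M d : nat) (D : 'M[R]_(L, M * d)) (v : 'cV[R]_(M * d)) :
  D *m v = \sum_i blk_mx D i *m blk_vec v i.
Proof.
apply/colP => r; rewrite mxE summxE sum_blkidx; apply: eq_bigr => i _.
by rewrite mxE; apply: eq_bigr => t _; rewrite !mxE.
Qed.

Lemma norm2_sqr_blocks (M d : nat) (v : 'cV[R]_(M * d)) :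
  norm2 v ^+ 2 = \sum_i norm2 (blk_vec v i) ^+ 2.
Proof.
rewrite norm2_sqr sum_blkidx; apply: eq_bigr => i _.
by rewrite norm2_sqr; apply: eq_bigr => t _; rewrite mxE.
Qed.

Lemma subD_mul (L M d : nat) (D : 'M[R]_(L, M * d)) (v : 'cV[R]_(M * d)) (S : {set 'I_M}) :
  subD D S *m subv v S = \sum_(i in S) blk_mx D i *m blk_vec v i.
Proof. by rewrite /subD /subv mul_mxrow_mxcol [RHS]big_enum_val. Qed.

Lemma subD_tr_mul_eq0 (L M d : nat) (D : 'M[R]_(L, M * d)) (S : {set 'I_M}) (z : 'cV[R]_L) :
  (subD D S)^T *m z = 0 -> forall i, i \in S -> (blk_mx D i)^T *m z = 0.
Proof.
rewrite /subD tr_mxrow mxcol_mul => /(congr1 (fun A => submxcol A)) h i iS.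
have := congr1 (fun f => f (enum_rank_in iS i)) h.
by rewrite mxcolK enum_rankK_in// submxcol0.
Qed.

Lemma gram_unitmx (m n : nat) (A : 'M[R]_(m, n)) : \rank A = n -> A^T *m A \in unitmx.
Proof.
move=> rA; rewrite -row_free_unit; apply/row_freeP.
have fA : row_free A^T by rewrite /row_free mxrank_tr rA.
suff /row_freeP : row_free (A^T *m A) by [].
rewrite -kermx_eq0; apply/eqP/row_matrixP => i; rewrite row0.
set u := row i _.
have uAA : u *m (A^T *m A) = 0 by rewrite /u -row_mul mulmx_ker row0.
have Au : A *m u^T = 0.
  apply/eqP; rewrite -norm2_eq0 -sqrf_eq0 norm2_dot /dotcv. rewrite trmx_mul trmxK.
  by rewrite mulmxA -(mulmxA u) uAA mul0mx mxE.
have uA : u *m A^T = 0 by apply: trmx_inj; rewrite trmx_mul trmxK Au trmx0.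
by apply: (row_free_inj fA); rewrite uA mul0mx.
Qed.

(** [BTH_output] constrains the estimate through every pseudoinverse, so one has to be exhibited;
    full column rank provides this explicit one. *)
Lemma is_pinv_gram (m n : nat) (A : 'M[R]_(m, n)) :
  \rank A = n -> is_pinv A (invmx (A^T *m A) *m A^T).
Proof.
move=> /gram_unitmx uG; set G := A^T *m A; set B := _ *m A^T.
have BA : B *m A = 1%:M by rewrite /B -mulmxA mulVmx.
have GT : G^T = G by rewrite /G trmx_mul trmxK.
split.
- by rewrite -mulmxA BA mulmx1.
- by rewrite BA mul1mx.
- by rewrite /B !trmx_mul trmxK trmx_inv GT mulmxA.
- by rewrite BA trmx1.
Qed.

Lemma BTH_normal_equations (L M d k : nat) (D : 'M[R]_(L, M * d)) (y : 'cV[R]_L)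
    (Shat : {set 'I_M}) (xhat : 'cV[R]_(M * d)) :
  \rank (subD D Shat) = (\sum_(j < #|Shat|) d)%N ->
  BTH_output D y k Shat xhat ->
  forall i, i \in Shat -> (blk_mx D i)^T *m (D *m xhat) = (blk_mx D i)^T *m y.
Proof.
move=> rD [_ _ x0 xpinv] i iS.
have xS := xpinv _ (is_pinv_gram _ _ _ rD).
have uG := gram_unitmx _ _ _ rD.
apply/eqP; rewrite -subr_eq0 -mulmxBr; apply/eqP.
move: i iS; apply: subD_tr_mul_eq0.
have -> : D *m xhat = subD D Shat *m subv xhat Shat.
  rewrite subD_mul mulmx_blocks [RHS]big_mkcond; apply: eq_bigr => i _.
  by case: ifPn => // /x0 ->; rewrite mulmx0.
by rewrite xS mulmxBr !mulmxA mulmxV// mul1mx subrr.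
Qed.

Lemma sub_coherence_le (L M d : nat) (D : 'M[R]_(L, M * d)) (l : 'I_M) (t u : 'I_d) :
  t != u -> `|\sum_r D r (blkidx l t) * D r (blkidx l u)| <= sub_coherence D.
Proof.
move=> tu; rewrite /sub_coherence.
apply: le_trans (le_bigmax_cond _ _ (j := l) _) => //.
apply: le_trans (le_bigmax_cond _ _ (j := t) _) => //.
apply: le_trans (le_bigmax_cond _ _ (j := u) _) => //.
by rewrite mxE le_eqVlt; apply/orP; left; apply/eqP; congr `|_|;
  apply: eq_bigr => r _; rewrite !mxE.
Qed.

Lemma sub_coherence_ge0 (L M d : nat) (D : 'M[R]_(L, M * d)) : 0 <= sub_coherence D.
Proof. exact: bigmax_ge_id. Qed.

Lemma blk_coherence_ge0 (L M d : nat) (D : 'M[R]_(L, M * d)) : 0 <= blk_coherence D.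
Proof. exact: bigmax_ge_id. Qed.

Lemma blk_coherence_le (L M d : nat) (D : 'M[R]_(L, M * d)) (i j : 'I_M) (v : 'cV[R]_d) :
  (0 < d)%N -> i != j ->
  norm2 ((blk_mx D i)^T *m (blk_mx D j *m v)) <= d%:R * blk_coherence D * norm2 v.
Proof.
move=> d0 ij; rewrite mulmxA; apply: le_trans (norm2_mulmx_opnorm _ _ _ _) _.
rewrite ler_wpM2r ?norm2_ge0// mulrC -ler_pdivrMr ?ltr0n//.
rewrite /blk_coherence.
apply: le_trans (le_bigmax_cond _ _ (j := i) _) => //.
exact: (le_bigmax_cond _ _ (j := j)).
Qed.

Lemma sqr_sum_norm_le (I : finType) (S : {set I}) (a : I -> R) :
  (forall i, i \notin S -> a i = 0) ->
  (\sum_i `|a i|) ^+ 2 <= #|S|%:R * \sum_i a i ^+ 2.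
Proof.
move=> aS; have := cauchy_schwarz_sum I (fun i => (i \in S)%:R) (fun i => `|a i|).
rewrite (eq_bigr (fun i => `|a i|)) => [/le_trans|i _]; last first.
  by case: (boolP (i \in S)) => [_|/aS ->]; rewrite ?mul1r// normr0 mulr0.
apply; rewrite le_eqVlt; apply/orP; left; apply/eqP; congr (_ * _).
  rewrite -sum1_card natr_sum [RHS]big_mkcond; apply: eq_bigr => i _.
  by case: (i \in S); rewrite ?expr1n ?expr0n.
by apply: eq_bigr => i _; rewrite real_normK ?num_real.
Qed.

(** The double sum is (sum |a_i|)^2 minus the diagonal, and Cauchy-Schwarz against the indicator of
    [S] bounds the square. It is applied at both scales: entries of a block with nu, blocks of the
    error with mu_B. *)
Lemma sum_sqr_offdiag_le (I : finType) (S : {set I}) (a : I -> R) :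
  (forall i, i \notin S -> a i = 0) ->
  \sum_i \sum_(j | i != j) `|a i| * `|a j| <= (#|S|%:R - 1) * \sum_i a i ^+ 2.
Proof.
move=> aS; have -> : \sum_i \sum_(j | i != j) `|a i| * `|a j| =
    (\sum_i `|a i|) ^+ 2 - \sum_i a i ^+ 2.
  rewrite expr2 mulr_suml -sumrB; apply: eq_bigr => i _.
  rewrite (bigD1 i (F := fun j => `|a j|))//= mulrDr -normrM -expr2.
  rewrite ger0_norm ?sqr_ge0// addrAC subrr add0r mulr_sumr; apply: eq_bigl => j.
  by rewrite eq_sym.
by rewrite mulrBl mul1r lerD2r sqr_sum_norm_le.
Qed.

(** Gershgorin in quadratic form: the block Gram matrix has unit diagonal and off-diagonal entries
    at most nu. The lower side serves recovery, the upper side the noise variance. *)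
Lemma blk_gram_bound (L M d : nat) (D : 'M[R]_(L, M * d)) (i : 'I_M) (v : 'cV[R]_d) :
  (forall j : 'I_(M * d), norm2 (col j D) = 1) ->
  `|norm2 (blk_mx D i *m v) ^+ 2 - norm2 v ^+ 2| <=
    (d%:R - 1) * sub_coherence D * norm2 v ^+ 2.
Proof.
move=> unitD.
pose G (t u : 'I_d) := \sum_r D r (blkidx i t) * D r (blkidx i u).
have G1 t : G t t = 1.
  have := congr1 (fun z => z ^+ 2) (unitD (blkidx i t)); rewrite norm2_sqr expr1n => <-.
  by apply: eq_bigr => r _; rewrite mxE expr2.
have -> : norm2 (blk_mx D i *m v) ^+ 2 = \sum_t \sum_u v t 0 * v u 0 * G t u.
  rewrite norm2_sqr.
  transitivity (\sum_r \sum_t \sum_u (D r (blkidx i t) * v t 0) * (D r (blkidx i u) * v u 0)).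
    apply: eq_bigr => r _; rewrite mxE expr2 mulr_suml; apply: eq_bigr => t _.
    by rewrite mulr_sumr; apply: eq_bigr => u _; rewrite !mxE.
  rewrite exchange_big; apply: eq_bigr => t _; rewrite exchange_big; apply: eq_bigr => u _.
  by rewrite mulr_sumr; apply: eq_bigr => r _; ring.
rewrite norm2_sqr -sumrB.
have -> : \sum_t (\sum_u v t 0 * v u 0 * G t u - v t 0 ^+ 2) =
    \sum_t \sum_(u | t != u) v t 0 * v u 0 * G t u.
  apply: eq_bigr => t _; rewrite (bigD1 t)//= G1 mulr1 -expr2 addrAC subrr add0r.
  by apply: eq_bigl => u; rewrite eq_sym.
apply: (@le_trans _ _ (\sum_t \sum_(u | t != u) `|v t 0| * `|v u 0| * sub_coherence D)).
  apply: le_trans (ler_norm_sum _ _ _) _; apply: ler_sum => t _.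
  apply: le_trans (ler_norm_sum _ _ _) _; apply: ler_sum => u tu.
  by rewrite !normrM ler_wpM2l// sub_coherence_le.
under eq_bigr do rewrite -mulr_suml.
rewrite -mulr_suml mulrAC ler_wpM2r ?sub_coherence_ge0//.
have := sum_sqr_offdiag_le 'I_d [set: 'I_d] (fun t => v t 0).
by rewrite cardsT card_ord; apply => t; rewrite inE.
Qed.

End Blocks.

(** * Recovery for a fixed noise vector *)

Section Recovery.
Context {R : realType}.
Variables (L M d k : nat) (D : 'M[R]_(L, M * d)) (x : 'cV[R]_(M * d)) (noise : 'cV[R]_L) (tau : R).
Hypothesis d_gt0 : (0 < d)%N.
Hypothesis unitD : forall j : 'I_(M * d), norm2 (col j D) = 1.
Hypothesis rankD :
  forall I : {set 'I_M}, (#|I| <= k)%N -> \rank (subD D I) = (\sum_(j < #|I|) d)%N.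
Hypothesis suppx : (#|bsupp x| <= k)%N.
Hypothesis x_neq0 : x != 0.
Hypothesis noise_lt : forall i, norm2 ((blk_mx D i)^T *m noise) < tau.

Let dmu : R := d%:R * blk_coherence D.
Let dnu : R := (d%:R - 1) * sub_coherence D.
Let S := bsupp x.
Let xmax := \big[Num.max/0]_(i in S) norm2 (blk_vec x i).
(** The default [xmax] does not alter the minimum over a nonempty [S], whose norms are all at most
    [xmax]. *)
Let xmin := \big[Num.min/xmax]_(i in S) norm2 (blk_vec x i).

Hypothesis gap : 2 * tau <= (1 - dnu) * xmin - (2 * k%:R - 1) * dmu * xmax.

Let dmu_ge0 : 0 <= dmu.
Proof. by rewrite mulr_ge0// blk_coherence_ge0. Qed.

Lemma blk_vec_notin_bsupp i : i \notin S -> blk_vec x i = 0.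
Proof. by rewrite inE negbK => /eqP. Qed.

Lemma norm2_blk_le_xmax i : norm2 (blk_vec x i) <= xmax.
Proof.
have [iS|/blk_vec_notin_bsupp ->] := boolP (i \in S); last by rewrite norm20 bigmax_ge_id.
exact: (le_bigmax_cond _ (fun i => norm2 (blk_vec x i))).
Qed.

Lemma xmin_le_norm2_blk i : i \in S -> xmin <= norm2 (blk_vec x i).
Proof. by move=> iS; exact: (bigmin_le_cond _ (fun i => norm2 (blk_vec x i))). Qed.

Lemma bsupp_neq0 : exists i0, i0 \in S.
Proof.
apply/set0Pn; apply: contraNneq x_neq0 => S0.
rewrite -norm2_eq0 -sqrf_eq0 norm2_sqr_blocks big1// => i _.
by rewrite blk_vec_notin_bsupp ?norm20 ?expr0n// S0 inE.
Qed.

(** Positivity of the denominators follows from the gap. Its left side is positive, so (1 - dnu)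
    xmin > 0 and 1 - dnu > 0; bounding xmin by xmax and dividing by xmax gives 1 - dnu > (2k - 1)
    dmu. *)
Lemma coherence_gap :
  [/\ 0 < tau, 0 < 1 - dnu & 0 < 1 - dnu - (k%:R - 1) * dmu].
Proof.
have [i0 i0S] := bsupp_neq0.
have tau0 : 0 < tau by rewrite (le_lt_trans (norm2_ge0 _ _) (noise_lt i0)).
have xmax0 : 0 < xmax.
  apply: lt_le_trans (norm2_blk_le_xmax i0); rewrite lt_def norm2_ge0 norm2_eq0 andbT.
  by move: i0S; rewrite inE.
have xmin0 : 0 <= xmin.
  by rewrite /xmin; apply: le_bigmin => [|i _]; [exact: ltW|exact: norm2_ge0].
have xminmax : xmin <= xmax by apply: le_trans (norm2_blk_le_xmax i0); exact: xmin_le_norm2_blk.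
have k1 : 1 <= k%:R :> R.
  by rewrite ler1n (leq_trans _ suppx)// card_gt0; apply/set0Pn; exists i0.
have h1 : 0 <= (2 * k%:R - 1) * dmu * xmax.
  by apply: mulr_ge0; [apply: mulr_ge0 => //; lra|exact: ltW].
have a0 : 0 < 1 - dnu.
  rewrite ltNge; apply/negP => a0.
  have : (1 - dnu) * xmin <= 0 by rewrite mulr_le0_ge0.
  by move: gap; lra.
split => //.
have h2 : (2 * k%:R - 1) * dmu * xmax < (1 - dnu) * xmax.
  have : (1 - dnu) * xmin <= (1 - dnu) * xmax by rewrite ler_wpM2l// ltW.
  by move: gap; lra.
move: h2; rewrite ltr_pM2r// => h2.
have h3 : (k%:R - 1) * dmu <= (2 * k%:R - 1) * dmu by rewrite ler_wpM2r//; lra.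
by lra.
Qed.

Lemma sum_cross_blocks_le i :
  norm2 (\sum_(j | j != i) (blk_mx D i)^T *m (blk_mx D j *m blk_vec x j)) <=
  #|S :\ i|%:R * (dmu * xmax).
Proof.
apply: le_trans (norm2_sum _ _ _ _) _.
have -> : #|S :\ i|%:R * (dmu * xmax) = \sum_(j in S :\ i) dmu * xmax.
  by rewrite sumr_const mulr_natl.
rewrite big_mkcond [leRHS]big_mkcond; apply: ler_sum => j _; rewrite in_setD1.
have [ji|ji] //= := boolP (j != i).
case: ifPn => [jS|/blk_vec_notin_bsupp ->]; last by rewrite !mulmx0 norm20.
apply: le_trans (blk_coherence_le _ _ _ _ _ _ _ d_gt0 _) _; first by rewrite eq_sym.
by rewrite ler_wpM2l// norm2_blk_le_xmax.
Qed.

Lemma correlation_split i :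
  (blk_mx D i)^T *m (D *m x + noise) =
  (blk_mx D i)^T *m (blk_mx D i *m blk_vec x i) +
  (\sum_(j | j != i) (blk_mx D i)^T *m (blk_mx D j *m blk_vec x j) +
   (blk_mx D i)^T *m noise).
Proof.
by rewrite mulmxDr mulmx_blocks mulmx_sumr (bigD1 i)//= addrA.
Qed.

Lemma norm2_gram_ge i (v : 'cV[R]_d) :
  (1 - dnu) * norm2 v <= norm2 ((blk_mx D i)^T *m (blk_mx D i *m v)).
Proof.
have [->|v0] := eqVneq v 0; first by rewrite !mulmx0 !norm20 mulr0.
have nv : 0 < norm2 v by rewrite lt_def norm2_eq0 v0 norm2_ge0.
rewrite -(ler_pM2r nv).
have := blk_gram_bound _ _ _ D i v unitD; rewrite -/dnu ler_norml => /andP[h _].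
have := dotcv_le _ ((blk_mx D i)^T *m (blk_mx D i *m v)) v.
rewrite dotcv_tr -norm2_dot ger0_norm ?sqr_ge0// => h2.
by move: h h2; rewrite expr2; lra.
Qed.

Lemma correlation_in_gt i : i \in S ->
  (1 - dnu) * xmin - (k%:R - 1) * dmu * xmax - tau < norm2 ((blk_mx D i)^T *m (D *m x + noise)).
Proof.
move=> iS; rewrite correlation_split.
have [_ a0 _] := coherence_gap.
apply: lt_le_trans (norm2B_ge _ _ _).
have h1 : (1 - dnu) * xmin <= norm2 ((blk_mx D i)^T *m (blk_mx D i *m blk_vec x i)).
  apply: le_trans (norm2_gram_ge _ _).
  by rewrite ler_wpM2l ?(ltW a0)// xmin_le_norm2_blk.
have h2 := norm2D _ (\sum_(j | j != i) (blk_mx D i)^T *m (blk_mx D j *m blk_vec x j))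
  ((blk_mx D i)^T *m noise).
have h3 := sum_cross_blocks_le i.
have h4 := noise_lt i.
have h5 : #|S :\ i|%:R * (dmu * xmax) <= (k%:R - 1) * dmu * xmax.
  rewrite mulrA ler_wpM2r ?(le_trans (norm2_ge0 _ _) (norm2_blk_le_xmax i))//.
  rewrite ler_wpM2r// lerBrDr natr1 ler_nat.
  by have := suppx; rewrite (cardsD1 i) iS.
by lra.
Qed.

Lemma correlation_notin_lt i : i \notin S ->
  norm2 ((blk_mx D i)^T *m (D *m x + noise)) < k%:R * dmu * xmax + tau.
Proof.
move=> iS; rewrite correlation_split blk_vec_notin_bsupp// !mulmx0 add0r.
apply: le_lt_trans (norm2D _ _ _) _; apply: ler_ltD; last exact: noise_lt.
apply: le_trans (sum_cross_blocks_le i) _; rewrite -mulrA ler_wpM2r//.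
  by rewrite mulr_ge0// (le_trans (norm2_ge0 _ _) (norm2_blk_le_xmax i)).
rewrite ler_nat (leq_trans _ suppx)//; apply: subset_leq_card; exact: subsetDl.
Qed.

Variables (Shat : {set 'I_M}) (xhat : 'cV[R]_(M * d)).
Hypothesis bth : BTH_output D (D *m x + noise) k Shat xhat.

Lemma BTH_support : S \subset Shat.
Proof.
have [cardS rho _ _] := bth.
apply/fintype.subsetP => i iS; apply/negPn/negP => iShat.
(* [Shat] has k elements, at least as many as [S]; missing one index of [S], it must contain a
   foreign one. *)
have [j jShat jS] : exists2 j, j \in Shat & j \notin S.
  apply/fintype.subsetPn; apply/negP => /subset_leqif_card [le eqS].
  have : #|Shat| == #|S| by rewrite eqn_leq le/= cardS suppx.
  by rewrite eqS => /fintype.subsetP/(_ i iS); rewrite (negbTE iShat).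
(* An index in [S] meets at most k - 1 interfering blocks, one outside meets at most k; they add up
   to the 2k - 1 of the gap, and the two noise terms to 2 tau. *)
have h1 := rho _ _ jShat iShat; have h2 := correlation_in_gt i iS.
have h3 := correlation_notin_lt j jS.
by move: gap; lra.
Qed.

(** For the error e, c |e|^2 <= |D e|^2 <= tau Y with Y the sum of its block norms, and Y^2 <= k
    |e|^2; squaring and cancelling |e|^2 concludes. Support recovery confines e to the k blocks of
    [Shat], whence k and k - 1 instead of about 2k. *)
Lemma BTH_error :
  norm2 (xhat - x) ^+ 2 <= k%:R * tau ^+ 2 / (1 - dnu - (k%:R - 1) * dmu) ^+ 2.
Proof.
have [cardS rho xhat0 _] := bth; have [tau0 a0 c0] := coherence_gap.
set c := 1 - dnu - _ in c0 *.
pose e := xhat - x; rewrite -/e.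
have blkB i : blk_vec e i = blk_vec xhat i - blk_vec x i.
  by apply/colP => t; rewrite !mxE.
have e0 i : i \notin Shat -> blk_vec e i = 0.
  move=> iS; rewrite blkB xhat0// blk_vec_notin_bsupp ?subrr//.
  by apply: contra iS; exact: (fintype.subsetP BTH_support).
have rankS : \rank (subD D Shat) = (\sum_(j < #|Shat|) d)%N by apply: rankD; rewrite cardS.
have normal_eq i : i \in Shat -> (blk_mx D i)^T *m (D *m e) = (blk_mx D i)^T *m noise.
  move=> iS; have := BTH_normal_equations _ _ _ _ _ _ _ _ rankS bth i iS.
  by rewrite /e mulmxBr mulmxBr => ->; rewrite mulmxDr addrAC subrr add0r.
pose Y := \sum_i norm2 (blk_vec e i); pose Q := norm2 e ^+ 2.
have QE : Q = \sum_i norm2 (blk_vec e i) ^+ 2 by rewrite /Q norm2_sqr_blocks.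
have Q0 : 0 <= Q by exact: sqr_ge0.
have ne0 i : i \notin Shat -> norm2 (blk_vec e i) = 0 by move=> /e0 ->; rewrite norm20.
have YY : Y ^+ 2 <= k%:R * Q.
  have := sqr_sum_norm_le _ Shat _ ne0; rewrite cardS -QE.
  by under eq_bigr do rewrite ger0_norm ?norm2_ge0//.
(* |D e|^2 splits into the products of D[i]^T D e with e[i]. On [Shat] the normal equations replace
   the first factor by correlated noise, of norm below tau; elsewhere e[i] = 0. *)
have upper : norm2 (D *m e) ^+ 2 <= tau * Y.
  rewrite norm2_dot {2}mulmx_blocks dotcv_sumr mulr_sumr; apply: ler_sum => i _.
  rewrite -dotcv_tr; have [iS|iS] := boolP (i \in Shat); last first.
    by rewrite e0// norm20 mulr0 /dotcv mulmx0 mxE.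
  rewrite normal_eq//; apply: le_trans (ler_norm _) _; apply: le_trans (dotcv_le _ _ _) _.
  by rewrite ler_wpM2r ?norm2_ge0// ltW.
have lower : c * Q <= norm2 (D *m e) ^+ 2.
  rewrite norm2_dot {2}mulmx_blocks dotcv_sumr.
  have -> : \sum_i dotcv L (D *m e) (blk_mx D i *m blk_vec e i) =
      \sum_i (norm2 (blk_mx D i *m blk_vec e i) ^+ 2 +
        \sum_(j | i != j) dotcv L (blk_mx D i *m blk_vec e i) (blk_mx D j *m blk_vec e j)).
    apply: eq_bigr => i _; rewrite dotcvC mulmx_blocks dotcv_sumr (bigD1 i)//= norm2_dot.
    by congr (_ + _); apply: eq_bigl => j; rewrite eq_sym.
  rewrite big_split/=.
  have h1 : (1 - dnu) * Q <= \sum_i norm2 (blk_mx D i *m blk_vec e i) ^+ 2.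
    rewrite QE mulr_sumr; apply: ler_sum => i _.
    have := blk_gram_bound _ _ _ D i (blk_vec e i) unitD.
    by rewrite -/dnu ler_norml => /andP[h _]; lra.
  have h2 : - (dmu * \sum_i \sum_(j | i != j) `|norm2 (blk_vec e i)| * `|norm2 (blk_vec e j)|) <=
      \sum_i \sum_(j | i != j) dotcv L (blk_mx D i *m blk_vec e i) (blk_mx D j *m blk_vec e j).
    rewrite mulr_sumr -sumrN; apply: ler_sum => i _.
    rewrite mulr_sumr -sumrN; apply: ler_sum => j ij.
    rewrite dotcvC -dotcv_tr !ger0_norm ?norm2_ge0//.
    have h := dotcv_le _ ((blk_mx D i)^T *m (blk_mx D j *m blk_vec e j)) (blk_vec e i).
    have h' := blk_coherence_le _ _ _ D i j (blk_vec e j) d_gt0 ij; rewrite -/dmu in h'.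
    have h'' : norm2 ((blk_mx D i)^T *m (blk_mx D j *m blk_vec e j)) * norm2 (blk_vec e i) <=
        dmu * norm2 (blk_vec e j) * norm2 (blk_vec e i) by rewrite ler_wpM2r ?norm2_ge0.
    have := ler_norml (dotcv d ((blk_mx D i)^T *m (blk_mx D j *m blk_vec e j)) (blk_vec e i))
      (dmu * (norm2 (blk_vec e i) * norm2 (blk_vec e j))).
    rewrite (le_trans h)//; last by move: h''; lra.
    by move=> /esym/andP[].
  have h3 : dmu * \sum_i \sum_(j | i != j) `|norm2 (blk_vec e i)| * `|norm2 (blk_vec e j)| <=
      dmu * ((k%:R - 1) * Q).
    by rewrite ler_wpM2l// QE -cardS sum_sqr_offdiag_le.
  by rewrite /c; lra.
have [Qz|Qn] := eqVneq Q 0.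
  by rewrite -/Q Qz divr_ge0 ?sqr_ge0// mulr_ge0 ?sqr_ge0.
have Qp : 0 < Q by rewrite lt_def Qn.
rewrite -/Q ler_pdivlMr ?exprn_gt0// -(ler_pM2r Qp).
have cQ : c * Q <= tau * Y by exact: le_trans upper.
apply: (@le_trans _ _ ((c * Q) ^+ 2)); first by rewrite exprMn; nra.
apply: (@le_trans _ _ ((tau * Y) ^+ 2)).
  by rewrite !expr2 ler_pM// mulr_ge0// ltW.
have : tau ^+ 2 * Y ^+ 2 <= tau ^+ 2 * (k%:R * Q) by apply: ler_wpM2l => //; exact: sqr_ge0.
by rewrite exprMn; lra.
Qed.

End Recovery.

(** * Union bound and conclusion *)

Lemma measure_bigsetU_le {R : realType} {dT : measure_display} {T : measurableType dT}
  (P : probability T R) (I : finType) (A : I -> set T) :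
  (forall i, measurable (A i)) ->
  measurable (\big[setU/set0]_i A i) /\ (P (\big[setU/set0]_i A i) <= \sum_i P (A i))%E.
Proof.
move=> mA; elim/big_rec2: _ => [|i p B _ [mB le]]; first by rewrite measure0.
split; first exact: measurableU.
by apply: le_trans (measureU2 _ _ _) _ => //; rewrite leeD2l.
Qed.

Lemma rank_subD_le {R : realType} (L M d k : nat) (D : 'M[R]_(L, M * d)) (i : 'I_M) :
  (0 < k)%N ->
  (forall I : {set 'I_M}, (#|I| <= k)%N -> \rank (subD D I) = (\sum_(j < #|I|) d)%N) ->
  (d <= L)%N.
Proof.
move=> k0 rankD.
have := rank_leq_row (subD D [set i]%SET); rewrite rankD ?cards1//.
by rewrite sum_nat_const card_ord mul1n.
Qed.

Lemma tail_constant {R : realType} (N alpha dR : R) : 0 < N ->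
  N * expR (- (2 * alpha * dR * ln N) / 2) = (N `^ (alpha * dR - 1))^-1.
Proof.
move=> N0; rewrite /powR gt_eqF// -expRN -{1}(lnK N0) -expRD; congr expR.
by field.
Qed.

Theorem theorem4 (R : realType) (dT : measure_display) (T : measurableType dT)
  (P : probability T R) (L M d k : nat) (D : 'M[R]_(L, M * d))
  (x : 'cV[R]_(M * d)) (sigma alpha : R) (w : 'I_L -> T -> R) :
  (L < M * d)%N ->
  (forall j : 'I_(M * d), norm2 (col j D) = 1) ->
  (forall I : {set 'I_M}, (#|I| <= k)%N -> \rank (subD D I) = (\sum_(j < #|I|) d)%N) ->
  (#|bsupp x| <= k)%N ->
  x != 0 ->
  0 < sigma ->
  (forall j, measurable_fun setT (w j)) ->
  mutually_independent P w ->
  (forall j (B : set R), measurable B -> P (w j @^-1` B) = normal_prob 0 sigma B) ->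
  let N : R := (M * d)%:R in
  let muB := blk_coherence D in
  let nu := sub_coherence D in
  let S := bsupp x in
  let xmax := \big[Num.max/0]_(i in S) norm2 (blk_vec x i) in
  let xmin := \big[Num.min/xmax]_(i in S) norm2 (blk_vec x i) in
  1 / (2 * d%:R * ln N) <= alpha ->
  (1 - (d%:R - 1) * nu) * xmin - (2 * k%:R - 1) * d%:R * muB * xmax
    >= 2 * sigma * Num.sqrt (2 * alpha * d%:R * (1 + (d%:R - 1) * nu) * ln N) ->
  exists E : set T, measurable E /\
    ((1 - (4 / 5) * d%:R * (2 * alpha * d%:R * ln N) `^ (d%:R / 2 - 1)
                      / N `^ (alpha * d%:R - 1))%:E < P E)%E /\
    forall omega, E omega ->
      forall (Shat : {set 'I_M}) (xhat : 'cV[R]_(M * d)),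
        BTH_output D (D *m x + \col_j w j omega) k Shat xhat ->
        S \subset Shat /\
        norm2 (xhat - x) ^+ 2 <=
          2 * alpha * (1 + (d%:R - 1) * nu)
            / (1 - (d%:R - 1) * nu - (k%:R - 1) * d%:R * muB) ^+ 2
            * d%:R * k%:R * sigma ^+ 2 * ln N.
Proof.
move=> LN unitD rankD suppx x_neq0 sigma_gt0 mw indw laww N muB nu S xmax xmin alphaT gap.
have iidw : iid_normal P sigma w by split.
have Md0 : (0 < M * d)%N by rewrite (leq_ltn_trans _ LN).
have [M0 d0] : (0 < M)%N /\ (0 < d)%N by move: Md0; rewrite muln_gt0 => /andP[].
pose i0 : 'I_M := Ordinal M0.
have k0 : (0 < k)%N.
  have [i iS] := bsupp_neq0 M d x x_neq0.
  by rewrite (leq_trans _ suppx)// card_gt0; apply/set0Pn; exists i.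
have dL : (d <= L)%N := rank_subD_le L M d k D i0 k0 rankD.
(* N > L >= d >= 1, where d <= L holds because a single block has full column rank; hence log N >
   0. *)
have N2 : 2 <= N.
  by rewrite /N ler_nat (leq_ltn_trans d0)// (leq_ltn_trans dL).
have N0 : 0 < N by lra.
have lnN0 : 0 < ln N by rewrite ln_gt0//; lra.
have dR : 1 <= d%:R :> R by rewrite ler1n.
pose t : R := 2 * alpha * d%:R * ln N.
have t1 : 1 <= t.
  by move: alphaT; rewrite ler_pdivrMr ?mulr_gt0//; rewrite /t; lra.
have nu0 : 0 <= nu by exact: sub_coherence_ge0.
pose lam : R := 1 + (d%:R - 1) * nu.
have lam0 : 0 < lam by rewrite ltr_pwDl// mulr_ge0// subr_ge0.
have s2 : 0 < sigma ^+ 2 by rewrite exprn_gt0.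
pose tau := sigma * Num.sqrt (2 * alpha * d%:R * lam * ln N).
have tau0 : 0 <= tau by rewrite mulr_ge0 ?sqrtr_ge0 ?ltW.
have tau2 : tau ^+ 2 = lam * (sigma ^+ 2 * t).
  rewrite exprMn sqr_sqrtr; first by rewrite /t; ring.
  have -> : 2 * alpha * d%:R * lam * ln N = t * lam by rewrite /t; ring.
  by rewrite mulr_ge0 ?ltW//; lra.
(* The bad events use a non-strict inequality, so that off their union the noise bound is strict, as
   recovery requires. *)
pose F (i : 'I_M) : set T :=
  [set u | lam * (sigma ^+ 2 * t) <= norm2 ((blk_mx D i)^T *m \col_j w j u) ^+ 2].
have mF i : measurable (F i).
  by apply: measurable_superlevel; exact: measurable_norm2_sqr_image.
pose K := two_peak sigma.
pose b : R := K * d%:R ^+ 2 * t `^ (d%:R / 2 - 1) * expR (- t / 2).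
have PF i : (P (F i) <= b%:E)%E.
  have := normal_image_tail P sigma sigma_gt0 d L (blk_mx D i)^T w lam (sigma ^+ 2 * t) iidw.
  have -> : sigma ^+ 2 * t / sigma ^+ 2 = t by rewrite mulrAC divff ?mul1r// gt_eqF.
  have -> : - (sigma ^+ 2 * t) / (2 * sigma ^+ 2) = - t / 2 by field; rewrite gt_eqF.
  apply => //; first by rewrite d0.
    by rewrite ler_peMr// ltW.
  move=> u; rewrite trmxK.
  have := blk_gram_bound L M d D i u unitD.
  by rewrite ler_norml => /andP[_]; rewrite /lam -/nu; lra.
have [mU PU] := measure_bigsetU_le P 'I_M F mF.
exists (~` \big[setU/set0]_i F i); split; first exact: measurableC.
split.
  have PUb : (P (\big[setU/set0]_i F i) <= (M%:R * b)%:E)%E.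
    apply: (le_trans PU); apply: (@le_trans _ _ (\sum_(i < M) b%:E)%E).
      by apply: lee_sum => i _; exact: PF.
    by rewrite sumEFin sumr_const card_ord mulr_natl.
  (* One factor d of d^2 joins M to form N, and N exp (- t / 2) = N^(1 - alpha d). Strictness comes
     from K < 4 / 5, all other factors being positive. *)
  have Mb : M%:R * b < 4 / 5 * d%:R * t `^ (d%:R / 2 - 1) / N `^ (alpha * d%:R - 1).
    rewrite -(tail_constant _ _ _ N0) -/t /b /N natrM.
    have -> : M%:R * (K * d%:R ^+ 2 * t `^ (d%:R / 2 - 1) * expR (- t / 2)) =
      K * (d%:R * t `^ (d%:R / 2 - 1) * (M%:R * d%:R * expR (- t / 2))) by ring.
    rewrite -!(mulrA (4 / 5)) ltr_pM2r ?two_peak_lt// !mulr_gt0 ?powR_gt0 ?expR_gt0 ?ltr0n//; lra.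
  rewrite probability_setC// -(@fineK _ (P _)) ?fin_num_measure// -EFinB lte_fin ltrD2l ltrN2.
  apply: le_lt_trans Mb; rewrite -lee_fin fineK// fin_num_measure//.
move=> u Eu Shat xhat bth.
have noise i : norm2 ((blk_mx D i)^T *m \col_j w j u) < tau.
  rewrite -(@ltr_pXn2r _ 2) ?nnegrE ?norm2_ge0// tau2 ltNge; apply/negP => Fi.
  by apply: Eu; rewrite (bigD1 i)//=; left.
have gap' : 2 * tau <= (1 - (d%:R - 1) * nu) * xmin - (2 * k%:R - 1) * (d%:R * muB) * xmax.
  by move: gap; rewrite /tau /lam !mulrA.
split.
  exact: (BTH_support L M d k D x _ tau d0 unitD suppx x_neq0 noise gap' Shat xhat bth).
have := BTH_error L M d k D x _ tau d0 unitD rankD suppx x_neq0 noise gap' Shat xhat bth.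
rewrite tau2 => /le_trans; apply; rewrite le_eqVlt; apply/orP; left; apply/eqP.
by rewrite /t /lam -/nu -/muB (mulrA (k%:R - 1)); ring.
Qed.
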